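(* There is an algorithm which, given two NFAs $\mathcal{A}_1,\mathcal{A}_2$ over a finite alphabet $A$, decides whether $L(\mathcal{A}_1)$ and $L(\mathcal{A}_2)$ are PT-separable, in time polynomial in both the number of states of the automata and the size $|A|$ of the alphabet.
   Context: For $u,v\in A^*$, write $u\lhd v$ ($u$ is a scattered subword of $v$) if $u=a_1\cdots a_n$ with $a_i\in A$ and $v=v_0a_1v_1\cdots v_{n-1}a_nv_n$ with $v_i\in A^*$. A regular language over $A$ is piecewise testable (PT) if it is a finite Boolean combination of languages of the form $A^*a_1A^*a_2\cdots A^*a_nA^*$ with $a_i\in A$; equivalently, there is $n$ such that $L$ is a union of classes of the equivalence $u\sim_n v \iff \mathrm{Sub}_n(u)=\mathrm{Sub}_n(v)$, where $\mathrm{Sub}_n(u)=\{w\in A^*: |w|\le n,\ w\lhd u\}$. Two languages $L_1,L_2$ are PT-separable if there exists a piecewise testable language $L$ with $L_1\subseteq L$ and $L\cap L_2=\varnothing$. *)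

(* Defs.v *)
From mathcomp Require Import all_boot.
Set Implicit Arguments. Unset Strict Implicit. Unset Printing Implicit Defensive.

Inductive ptexpr (k : nat) : Type :=
  | PPiece of seq 'I_k          (* the language A^*a1A^*...A^*anA^* = { v | a1..an <| v } *)
  | PNot of ptexpr k
  | POr of ptexpr k & ptexpr k
  | PAnd of ptexpr k & ptexpr k.

Fixpoint pt_eval k (e : ptexpr k) (v : seq 'I_k) : bool :=
  match e with
  | PPiece w => subseq w v
  | PNot e1 => ~~ pt_eval e1 v
  | POr e1 e2 => pt_eval e1 v || pt_eval e2 v
  | PAnd e1 e2 => pt_eval e1 v && pt_eval e2 v
  end.

Definition PT_separable k (L1 L2 : seq 'I_k -> Prop) : Prop :=
  exists e : ptexpr k,
    (forall v, L1 v -> pt_eval e v) /\ (forall v, L2 v -> ~~ pt_eval e v).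

Record nfa (k n : nat) := NFA {
  nfa_init  : {set 'I_n};
  nfa_final : {set 'I_n};
  nfa_trans : 'I_n -> 'I_k -> {set 'I_n} }.

Definition nfa_reach k n (M : nfa k n) (w : seq 'I_k) : {set 'I_n} :=
  foldl (fun (S : {set 'I_n}) (a : 'I_k) => \bigcup_(q in S) nfa_trans M q a) (nfa_init M) w.

Definition nfa_lang k n (M : nfa k n) : seq 'I_k -> Prop :=
  fun w => [exists q, (q \in nfa_reach M w) && (q \in nfa_final M)].

Definition enc_set n (S : {set 'I_n}) : seq nat :=
  [seq nat_of_bool (q \in S) | q <- enum 'I_n].

Definition enc_nfa k n (M : nfa k n) : seq nat :=
  n :: enc_set (nfa_init M) ++ enc_set (nfa_final M) ++
  flatten [seq flatten [seq enc_set (nfa_trans M q a) | a <- enum 'I_k]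
          | q <- enum 'I_n].

Definition enc_input k n1 n2 (M1 : nfa k n1) (M2 : nfa k n2) : seq nat :=
  k :: enc_nfa M1 ++ enc_nfa M2.

(* ---------- Machine model: unit-cost RAM with + and - and indirect addressing ---- *)
Inductive instr : Type :=
  | IConst of nat & nat
  | IAdd of nat & nat & nat
  | ISub of nat & nat & nat    (* ISub i j l : M[i] := M[j] - M[l] (truncated) *)
  | ILoad of nat & nat
  | IStore of nat & nat
  | IJz of nat & nat
  | IHalt.

Definition mem := nat -> nat.
Definition upd (M : mem) (i v : nat) : mem := fun j => if j == i then v else M j.

Definition config := (nat * mem)%type.

Definition halted (P : seq instr) (c : config) : bool :=
  match nth IHalt P c.1 with IHalt => true | _ => false end.

Definition step (P : seq instr) (c : config) : config :=
  let: (pc, M) := c in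
  match nth IHalt P pc with
  | IConst i v => (pc.+1, upd M i v)
  | IAdd i j l => (pc.+1, upd M i (M j + M l))
  | ISub i j l => (pc.+1, upd M i (M j - M l))
  | ILoad i j => (pc.+1, upd M i (M (M j)))
  | IStore i j => (pc.+1, upd M (M i) (M j))
  | IJz i t => (if M i == 0 then t else pc.+1, M)
  | IHalt => (pc, M)
  end.

Definition init_mem (s : seq nat) : mem := fun i => nth 0 (size s :: s) i.

Definition run (P : seq instr) (t : nat) (s : seq nat) : config :=
  iter t (step P) (0, init_mem s).

Definition halts_within (P : seq instr) (t : nat) (s : seq nat) : bool :=
  halted P (run P t s).

Definition output (P : seq instr) (t : nat) (s : seq nat) : nat := (run P t s).2 0.

(* Main.v *)
(* Non-separability.  If for every n some u in L1 and v in L2 have the same subwords of length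
   at most n, then both automata share a path made of synchronous letters and of jumps through a
   loop with a common alphabet B: factor u over a pattern of letters and stars B^* (an ideal of
   the subword order).  Non-membership in an ideal is witnessed by a short subword, so v factors
   over the same pattern; if a letter of the pattern is skipped, or a star B^* is matched by fewer
   than N full-alphabet factors, u or v belongs to an ideal of smaller weight, and one recurses.
   At the end each star is matched by so many full-alphabet factors that both automata loop on B.
   Conversely, pumping the loops of a common path gives words agreeing on all short subwords.

   Algorithm.  For every pair of states (q1, q2) the largest alphabet of a common loop is a
   greatest fixpoint, computed by restricted reachability; the pairs reachable by letters and
   jumps are then a least fixpoint.  Both are written as bounded-loop programs filling tables,
   which are compiled to the RAM with a syntactic polynomial cost bound. *)
Require Import Defs.
From mathcomp Require Import all_boot zify.
From Stdlib Require Import Classical_Prop.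
Set Implicit Arguments. Unset Strict Implicit. Unset Printing Implicit Defensive.


(** The length of the subwords to inspect is governed by the weight of A^*, namely (2N+1)^|A| with N
    the number of states. This exponential bound occurs only in the correctness proof; the program
    never handles words. N full-alphabet factors suffice for a star because the N+1 states met at
    their ends must repeat. On the algorithmic side the obstacle is the choice of the alphabet B
    among 2^|A| sets. It disappears because a jump through B at a pair of states is also a jump
    through any larger alphabet that still loops there, so one maximal alphabet per pair is enough.
    The two automata are merged into a disjoint union, so that pairs of states, tables and index
    arithmetic share the single size n1+n2. The RAM has no multiplication and, at the start, no free
    low cells: products become sums, and the input has to be moved away before these cells can serve
    as registers. *)

(** * Subwords and the equivalence by short subwords *)

Section Subwords.
Variable A : finType.
Implicit Types (u v w : seq A) (B : {set A}) (n N : nat).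

Lemma subseq_catP w u v :
  reflect (exists w1 w2, [/\ w = w1 ++ w2, subseq w1 u & subseq w2 v])
          (subseq w (u ++ v)).
Proof.
apply: (iffP idP) => [|[w1 [w2 [-> s1 s2]]]]; last exact: cat_subseq.
elim: u w => [|a u IHu] w; first by exists [::], w.
case: w => [|b w]; first by exists [::], [::]; rewrite !sub0seq.
rewrite /=; case: eqP => [<-|ne] /IHu [w1 [w2 [e s1 s2]]].
  by exists (b :: w1), w2; rewrite e /= eqxx.
case: w1 e s1 => [|c w1] /= e s1; first by exists [::], w2; rewrite e.
case: e => ec ew; exists (b :: w1), w2; split=> //=; first by rewrite ew.
by subst c; case: eqP ne.
Qed.

Definition sim n u v := forall w, size w <= n -> subseq w u = subseq w v.

Lemma sim_sym n u v : sim n u v -> sim n v u.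
Proof. by move=> s w /s ->. Qed.

Lemma sim_cat n u v u' v' : sim n u v -> sim n u' v' -> sim n (u ++ u') (v ++ v').
Proof.
suff H x y x' y' : sim n x y -> sim n x' y' ->
    forall w, size w <= n -> subseq w (x ++ x') -> subseq w (y ++ y').
  by move=> s s' w le; apply/idP/idP; apply: H => //; apply: sim_sym.
move=> s s' w le /subseq_catP[w1 [w2 [e s1 s2]]]; move: le; rewrite e size_cat => le.
by apply: cat_subseq; [rewrite -s | rewrite -s'] => //; lia.
Qed.

(** A finite list of candidates for the distinguishing subwords from which a separating expression
    is built. *)
Fixpoint words n : seq (seq A) :=
  if n is m.+1 then [::] :: [seq a :: w | a <- enum A, w <- words m] else [:: [::]].

Lemma mem_words n w : size w <= n -> w \in words n.
Proof.
elim: n w => [|n IHn] [|a w] //= le.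
by rewrite inE /=; apply/allpairsP; exists (a, w); rewrite mem_enum IHn.
Qed.

(** * Ideals of the subword order *)

(* The atom [inl a] stands for {empty word, a} and [inr B] for B^*. *)
Definition pattern := seq (A + {set A}).
Implicit Type ps : pattern.

(** [ideal_skip] lets any atom contribute nothing and also ends a star; this is what makes the
    language closed under subwords. *)
Inductive ideal : pattern -> seq A -> Prop :=
  | ideal_nil : ideal [::] [::]
  | ideal_skip t ps u : ideal ps u -> ideal (t :: ps) u
  | ideal_letter a ps u : ideal ps u -> ideal (inl a :: ps) (a :: u)
  | ideal_star B ps a u : a \in B -> ideal (inr B :: ps) u -> ideal (inr B :: ps) (a :: u).

Lemma ideal0 ps : ideal ps [::].
Proof. by elim: ps => [|t ps IH]; constructor. Qed.

Lemma ideal_sub ps u w : ideal ps u -> subseq w u -> ideal ps w.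
Proof.
move=> H; elim: H w => {ps u} [|t ps u _ IH|a ps u _ IH|B ps a u aB _ IH] w.
- by rewrite subseq0 => /eqP->; constructor.
- by move/IH; apply: ideal_skip.
- case: w => [_|b w /=]; first exact: ideal0.
  case: eqP => [->|_] /IH ?; first exact: ideal_letter.
  exact: ideal_skip.
case: w => [_|b w /=]; first exact: ideal0.
by case: eqP => [->|_] /IH ? //; apply: ideal_star.
Qed.

Lemma ideal_cat ps ps' u u' : ideal ps u -> ideal ps' u' -> ideal (ps ++ ps') (u ++ u').
Proof. by move=> H H'; elim: H => //= *; constructor. Qed.

Lemma ideal_stars B ps u v : {subset u <= B} -> ideal ps v -> ideal (inr B :: ps) (u ++ v).
Proof.
move=> + H; elim: u => [_|a u IHu sub] /=; first exact: ideal_skip.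
apply: ideal_star; first by apply: sub; rewrite mem_head.
by apply: IHu => x xu; apply: sub; rewrite inE xu orbT.
Qed.

Lemma ideal_cons_inv t ps a u : ideal (t :: ps) (a :: u) ->
  match t with inl b => b != a | inr B => a \notin B end -> ideal ps (a :: u).
Proof.
move=> H; inversion H; subst => //; first by rewrite eqxx.
by move/negP=> nB; case: nB.
Qed.

Lemma ideal_letter_inv a ps u : ideal (inl a :: ps) u ->
  ideal ps u \/ exists2 v, u = a :: v & ideal ps v.
Proof. by move=> H; inversion H; subst; [left | right; eexists; first by []]. Qed.

Lemma ideal_star_inv B ps u : ideal (inr B :: ps) u ->
  exists u1 u2, [/\ u = u1 ++ u2, {subset u1 <= B} & ideal ps u2].
Proof.
elim: u => [|a u IHu] I; first by exists [::], [::]; split=> //; apply: ideal0.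
inversion I as [|? ? ? I'| |? ? ? ? aB I']; subst; first by exists [::], (a :: u).
case: (IHu I') => u1 [u2 [-> sub ?]]; exists (a :: u1), u2; split=> // x.
by rewrite inE => /orP[/eqP->|/sub].
Qed.

(** Each atom costs the witness at most one letter: a letter that the first atom rejects forces this
    atom to be skipped, and what follows is a witness against the remaining atoms. *)
Lemma ideal_excluded ps u :
  ideal ps u \/ exists w, [/\ size w <= (size ps).+1, subseq w u & ~ ideal ps w].
Proof.
elim: ps u => [|t ps IHps] u.
  case: u => [|c u]; [left; constructor | right; exists [:: c]].
  by split=> //=; rewrite ?eqxx ?sub0seq // => H; inversion H.
have escape c u0 : match t with inl b => b != c | inr B => c \notin B end ->
    ideal (t :: ps) (c :: u0) \/
    exists w, [/\ size w <= (size ps).+2, subseq w (c :: u0) & ~ ideal (t :: ps) w].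
  move=> out; case: (IHps (c :: u0)) => [|[w [le s no]]]; first by left; apply: ideal_skip.
  right; case: w le s no => [_ _ []|x w le s no]; first exact: ideal0.
  (* A witness for the tail pattern that already starts with [c] serves as it is, since a second [c]
     need not be available in the word. Otherwise it embeds in [u0], and [c] can be put in front. *)
  case: (x =P c) => [xc|/eqP xc].
    subst x; exists (c :: w); split=> //; first by apply: leq_trans le _.
    by move=> I; apply: no; apply: ideal_cons_inv I out.
  exists (c :: x :: w); split=> //; first by move: s; rewrite /= eqxx (negbTE xc).
  move=> I; apply: no; apply: ideal_sub (ideal_cons_inv I out) _.
  exact: subseq_cons.
elim: u => [|c u IHu]; first by left; apply: ideal0.
case: t escape IHu => [b|B] escape IHu.
  case: (boolP (b != c)) => [/escape //|/negPn/eqP<-].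
  case: (IHps u) => [|[w [le s no]]]; first by left; apply: ideal_letter.
  right; exists (b :: w); split=> //=; first by rewrite eqxx.
  move/ideal_letter_inv=> [I|[_ [<-] I]]; apply: no => //.
  exact: ideal_sub I (subseq_cons _ _).
case: (boolP (c \notin B)) => [/escape //|/negPn cB].
case: IHu => [I|[w [le s no]]]; first by left; apply: ideal_star.
by right; exists w; split=> //; apply: subseq_trans s (subseq_cons _ _).
Qed.

(** * Rich factors, matching and weights of patterns *)

Inductive rich B : nat -> seq A -> Prop :=
  | rich0 u : {subset u <= B} -> rich B 0 u
  | richS N u v : u =i B -> rich B N v -> rich B N.+1 (u ++ v).

(** The tight counterpart of [ideal]: no atom can be skipped, so two words matching the same pattern
    can be followed atom by atom in parallel. *)
Inductive matches N : pattern -> seq A -> Prop :=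
  | matches_nil : matches N [::] [::]
  | matches_letter a ps u : matches N ps u -> matches N (inl a :: ps) (a :: u)
  | matches_star B ps u v :
      rich B N u -> matches N ps v -> matches N (inr B :: ps) (u ++ v).

(** A star over B that is not read richly becomes at most N stars over |B|-1 letters, with at most N
    single letters. With W the weight of such a smaller star this costs at most N(W+1) <= 2NW <
    (2N+1)W, hence the base 2N+1. *)
Definition atom_weight N (t : A + {set A}) :=
  if t is inr B then (2 * N).+1 ^ #|B| else 1.
Definition weight N ps := \sum_(t <- ps) atom_weight N t.

Lemma atom_weight_gt0 N t : 0 < atom_weight N t.
Proof. by case: t => //= B; rewrite expn_gt0. Qed.

Lemma size_weight N ps : size ps <= weight N ps.
Proof.
by rewrite -sum1_size; apply: leq_sum => t _; apply: atom_weight_gt0.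
Qed.

(** Last letters are deleted while the word still contains all of [B]; the letter whose deletion
    would fail is [b], which therefore does not occur before. *)
Lemma shortest_full_prefix B u : B != set0 -> {subset B <= u} ->
  exists x b y, [/\ u = x ++ b :: y, b \in B, b \notin x & {subset B <= rcons x b}].
Proof.
move=> /set0Pn[b0 b0B]; elim/last_ind: u => [/(_ _ b0B) //|u c IHu sub].
case: (boolP [forall b in B, b \in u]) => [/forall_inP H|].
  case: IHu => // x [b [y [-> ? ? ?]]].
  by exists x, b, (rcons y c); rewrite rcons_cat rcons_cons.
rewrite negb_forall_in => /exists_inP[b bB bu]; exists u, c, [::].
have bc: b = c by have := sub _ bB; rewrite mem_rcons inE (negbTE bu) orbF => /eqP.
by subst c; split=> //; rewrite cats1.
Qed.

Lemma sub_setD1 B b u : {subset u <= B} -> b \notin u -> {subset u <= B :\ b}.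
Proof. by move=> sub bu x xu; rewrite !inE sub // andbT; apply: contraNneq bu => <-. Qed.

(** Cut off shortest full prefixes greedily. Each one is a word missing a letter followed by that
    letter, so if fewer than M cuts are possible, [u] is described by stars over smaller alphabets
    separated by letters. *)
Lemma poor_split B M u : {subset u <= B} ->
  rich B M u \/ exists2 ps, ideal ps u &
    exists2 b, b \in B & forall N, weight N ps <= M * ((2 * N).+1 ^ #|B :\ b|).+1.
Proof.
elim: M u => [|M IHM] u sub; first by left; constructor.
have [B0|Bn0] := eqVneq B set0.
  have -> : u = [::] by case: u sub => // a u /(_ a (mem_head _ _)); rewrite B0 inE.
  left; apply: (@richS B M [::] [::]); first by move=> x; rewrite B0 inE.
  by elim: M {IHM} => [|M H]; [constructor | apply: (@richS B M [::] [::]) => // x; rewrite B0 inE].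
case: (boolP [forall b in B, b \in u]) => [/forall_inP H|]; last first.
  rewrite negb_forall_in => /exists_inP[b bB bu]; right; exists [:: inr (B :\ b)].
    by rewrite -[u]cats0; apply: ideal_stars (sub_setD1 sub bu) ideal_nil.
  by exists b => // N; rewrite /weight big_seq1 /=; lia.
have [x [b [y [eu bB bx full]]]] := shortest_full_prefix Bn0 H.
have subx : {subset x <= B} by move=> z zx; apply: sub; rewrite eu mem_cat zx.
case: (IHM y) => [z zy|ry|[ps Ips [b' b'B wps]]].
- by apply: sub; rewrite eu mem_cat inE zy !orbT.
- left; rewrite eu -cat_rcons; apply: richS => // z.
  apply/idP/idP => [|/full //]; rewrite mem_rcons inE => /orP[/eqP->//|/subx //].
right; exists (inr (B :\ b) :: inl b :: ps).
  by rewrite eu; apply: ideal_stars (sub_setD1 subx bx) (ideal_letter _ Ips).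
exists b => // N; have := wps N.
(* The cuts may lose different letters; only the common cardinality enters the bound. *)
have -> : #|B :\ b'| = #|B :\ b|.
  by have := cardsD1 b B; rewrite (cardsD1 b' B) bB b'B => /addnI.
by rewrite /weight !big_cons /=; nia.
Qed.

(** The descent step: a skipped letter deletes an atom, and a star read poorly is exchanged for the
    cheaper pattern of [poor_split]. *)
Lemma ideal_matches_or_smaller N ps u : ideal ps u ->
  matches N ps u \/ exists2 ps', ideal ps' u & weight N ps' < weight N ps.
Proof.
elim: ps u => [|t ps IHps] u I; first by inversion I; left; constructor.
have drop : ideal ps u ->
    exists2 ps', ideal ps' u & weight N ps' < weight N (t :: ps).
  by exists ps => //; rewrite /weight big_cons -[ltnLHS]add0n ltn_add2r atom_weight_gt0.
case: t I drop => [a|B] I drop.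
  case: (ideal_letter_inv I) => [|[v -> Iv]]; first by right; apply: drop.
  case: (IHps _ Iv) => [?|[ps' I' lt]]; [by left; constructor | right].
  exists (inl a :: ps'); first exact: ideal_letter.
  by rewrite /weight !big_cons ltn_add2l.
have [u1 [u2 [-> sub {}I]]] := ideal_star_inv I.
case: (poor_split N sub) => [r|[ps1 I1 [b bB /(_ N) w1]]]; last first.
  right; exists (ps1 ++ ps); first exact: ideal_cat.
  rewrite /weight big_cat big_cons /= ltn_add2r; apply: leq_ltn_trans w1 _.
  (* With W = (2N+1)^(|B|-1) > 0 it remains to see N(W+1) < (2N+1)W. *)
  rewrite (cardsD1 b B) bB expnS.
  have : 0 < (2 * N).+1 ^ #|B :\ b| by rewrite expn_gt0.
  nia.
case: (IHps _ I) => [?|[ps' I' lt]]; [by left; constructor | right].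
by exists (inr B :: ps'); [apply: ideal_stars | rewrite /weight !big_cons ltn_add2l].
Qed.

(** Induction on the weight. Equivalent words lie in the same ideals of weight below [n], so
    whichever of the two fails to match supplies a smaller ideal containing both. *)
Lemma sim_common_match N n ps u v :
  weight N ps < n -> sim n u v -> ideal ps u ->
  exists ps', matches N ps' u /\ matches N ps' v.
Proof.
have [m] := ubnP (weight N ps).
elim: m ps u v => // m IHm ps u v lem ltn s Iu.
(* An excluding witness has at most [size ps + 1] letters, and [size ps] is at most the weight,
   hence below [n]: the witness would be a subword of [u] too. *)
have Iv : ideal ps v.
  case: (ideal_excluded ps v) => // -[w [le wv no]]; case: no.
  apply: ideal_sub Iu _; rewrite s //; apply: leq_trans le _.
  exact: leq_ltn_trans (size_weight N _) ltn.
case: (ideal_matches_or_smaller N Iu) => [mu|[ps' I' lt]]; last first.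
  by apply: (IHm ps') => //; lia.
case: (ideal_matches_or_smaller N Iv) => [mv|[ps' I' lt]]; first by exists ps.
(* Here the smaller ideal is known to contain [v], so the two words exchange their roles. *)
case: (IHm ps' v u) => [|||//|ps2 [? ?]]; try lia.
  exact: sim_sym.
by exists ps2.
Qed.

(** * Products of automata with jumps *)

Section Automaton.
Variables (Q : finType) (tr : Q -> A -> Q -> bool).

Fixpoint walk p w q : Prop :=
  if w is a :: w' then exists2 p', tr p a p' & walk p' w' q else p = q.

Lemma walk_cat p u v q : walk p (u ++ v) q <-> exists2 r, walk p u r & walk r v q.
Proof.
elim: u p => [|a u IHu] p /=; first by split=> [|[r -> //]]; exists p.
split=> [[p' t /IHu[r ? ?]]|[r [p' t ?] ?]]; first by exists r => //; exists p'.
by exists p' => //; apply/IHu; exists r.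
Qed.

Definition conn B p q := exists2 w, {subset w <= B} & walk p w q.
Definition full B p q := exists2 w, w =i B & walk p w q.
(** A letter-by-letter form of [full B q q], which restricted reachability can test without building
    a word that uses all of [B]. *)
Definition loops B q := forall b, b \in B ->
  exists x y, [/\ conn B q x, tr x b y & conn B y q].

Lemma conn_refl B p : conn B p p. Proof. by exists [::]. Qed.

Lemma conn_trans B p q r : conn B p q -> conn B q r -> conn B p r.
Proof.
move=> [u su pu] [v sv pv]; exists (u ++ v); last by apply/walk_cat; exists q.
by move=> x; rewrite mem_cat => /orP[/su|/sv].
Qed.

Lemma full_conn B p q : full B p q -> conn B p q.
Proof. by case=> w e ?; exists w => // x; rewrite e. Qed.

Lemma full_trans B p q r : full B p q -> full B q r -> full B p r.
Proof.
move=> [u su pu] [v sv pv]; exists (u ++ v); last by apply/walk_cat; exists q.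
by move=> x; rewrite mem_cat su sv orbb.
Qed.

Lemma full_loops B q : full B q q -> loops B q.
Proof.
move=> [w e /[swap] b +] bB; rewrite -e in bB.
case/splitPr: bB e => u v e /walk_cat[x xu /= [y t yv]].
by exists x, y; split=> //; [exists u | exists v] => // z zu;
  rewrite -e mem_cat ?inE zu ?orbT.
Qed.

(** Concatenate one closed walk at [q] for each letter of [B]. *)
Lemma loops_full B q : loops B q -> full B q q.
Proof.
move=> L; suff H (s : seq A) : {subset s <= B} ->
    exists2 w, {subset w <= B} /\ {subset s <= w} & walk q w q.
  have [x|w [sw wB] ?] := H (enum B); first by rewrite mem_enum.
  exists w => // x; apply/idP/idP => [/sw//|xB].
  by apply: wB; rewrite mem_enum.
elim: s => [_|b s IHs sub]; first by exists [::].
have [x sx|w [sw ws] wq] := IHs; first by apply: sub; rewrite inE sx orbT.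
have [|x [y [[u su xu] t [v sv yv]]]] := L b; first by rewrite sub ?mem_head.
exists (u ++ b :: v ++ w).
  split=> z; rewrite !(mem_cat, inE).
    case/or4P=> [/su //|/eqP->|/sv //|/sw //]; exact: sub (mem_head _ _).
  by move=> /orP[->|/ws->]; rewrite !orbT.
apply/walk_cat; exists x => //=; exists y => //; apply/walk_cat.
by exists q.
Qed.

(** Pigeonhole on the states between consecutive full factors: a repeated state carries a closed
    walk whose letters are exactly [B]. *)
Lemma rich_loop B M u p s : #|Q| <= M -> rich B M u -> walk p u s ->
  exists q, [/\ conn B p q, loops B q & conn B q s].
Proof.
(* The empty set is generalised to the set [S] of states already met, each joined to the current one
   by a full word; [M + #|S|] stays at least [#|Q|]. *)
move=> le; have : (forall z, z \in (set0 : {set Q}) -> full B z p) by move=> z; rewrite inE.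
have : #|Q| <= M + #|(set0 : {set Q})| by rewrite cards0 addn0.
move: (set0 : {set Q}) => S {le} + + r; elim: r p S => {M u} [u sub|M u v eB r IHr] p S le fS.
  move=> pu; exists p; split; [exact: conn_refl | | by exists u].
  apply/full_loops/fS; suff -> : S = setT by rewrite inE.
  by apply/eqP; rewrite eqEcard subsetT cardsT.
case/walk_cat=> p' pu p'v; have fpp : full B p p' by exists u.
case: (boolP (p \in S)) => pS.
  exists p; split; [exact: conn_refl | exact/full_loops/fS |].
  apply: conn_trans (full_conn fpp) _; exists v => //.
  move: r; clear; elim=> {M v} // M u v eB _ IH x.
  by rewrite mem_cat eB => /orP[//|/IH].
case: (IHr p' (p |: S)) => [|z|//|q [c l c']].
- by rewrite cardsU1 pS; lia.
- rewrite !inE => /orP[/eqP->//|/fS fz]; exact: full_trans fz fpp.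
by exists q; split=> //; apply: conn_trans (full_conn fpp) c.
Qed.

Definition sync (p r : Q * Q) := exists2 a, tr p.1 a r.1 & tr p.2 a r.2.
Definition jump (p r : Q * Q) := exists (B : {set A}) (q : Q * Q),
  [/\ loops B q.1, loops B q.2, conn B p.1 q.1 /\ conn B p.2 q.2
    & conn B q.1 r.1 /\ conn B q.2 r.2].

Inductive reaches p : Q * Q -> Prop :=
  | reaches_refl : reaches p p
  | reaches_sync q r : reaches p q -> sync q r -> reaches p r
  | reaches_jump q r : reaches p q -> jump q r -> reaches p r.

Lemma reaches_trans p q r : reaches p q -> reaches q r -> reaches p r.
Proof.
move=> pq; elim=> // q' r' _ IH; [exact: reaches_sync IH | exact: reaches_jump IH].
Qed.

(** The common pattern synchronises the two walks: a letter becomes a synchronous step, and a star,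
    rich in both words, yields loops over one and the same alphabet. *)
Lemma matches_reaches N ps u v p1 p2 r1 r2 : #|Q| <= N ->
  matches N ps u -> matches N ps v -> walk p1 u r1 -> walk p2 v r2 ->
  reaches (p1, p2) (r1, r2).
Proof.
move=> le mu; elim: mu v p1 p2 => {ps u} [|a ps u _ IH|B ps u u' ru _ IH] v p1 p2 mv.
- by inversion mv; subst => -> ->; constructor.
- inversion mv as [|? ? ? mv'|]; subst => -[s1 t1 w1] [s2 t2 w2].
  apply: reaches_trans (IH _ _ _ mv' w1 w2).
  by apply: reaches_sync (reaches_refl _) _; exists a.
inversion mv as [| |? ? ? ? rv mv']; subst => /walk_cat[s1 w1 w1'] /walk_cat[s2 w2 w2'].
apply: reaches_trans (IH _ _ _ mv' w1' w2').
have [q1 [c1 l1 d1]] := rich_loop le ru w1.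
have [q2 [c2 l2 d2]] := rich_loop le rv w2.
by apply: reaches_jump (reaches_refl _) _; exists B, (q1, q2).
Qed.

Lemma subseq_rep B l n w : {subset B <= l} -> {subset w <= B} -> size w <= n ->
  subseq w (flatten (nseq n l)).
Proof.
move=> Bl; elim: n w => [|n IHn] [|a w] // sub le; first exact: sub0seq.
rewrite /= -[a :: w]cat1s; apply: cat_subseq.
  by rewrite sub1seq; apply/Bl/sub/mem_head.
by apply: IHn => // x xw; apply: sub; rewrite inE xw orbT.
Qed.

(** Repeat the full loop [n] times. Up to length [n] the subwords are then all words over [B], which
    does not depend on the automaton. *)
Lemma jump_word B p q r n : loops B q -> conn B p q -> conn B q r ->
  exists2 u, walk p u r &
    forall w, size w <= n -> subseq w u <-> {subset w <= B}.
Proof.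
move=> /loops_full[l el ql] [x sx px] [y sy qy].
exists (x ++ flatten (nseq n l) ++ y) => [|w le].
  apply/walk_cat; exists q => //; apply/walk_cat; exists q => //.
  by elim: n => //= n IH; apply/walk_cat; exists q.
split=> [/mem_subseq s z /s|sub].
  rewrite !mem_cat => /or3P[/sx //| |/sy //].
  by elim: n {le s} => //= n IH; rewrite mem_cat el => /orP[//|/IH].
rewrite -[w]cat0s; apply: cat_subseq; first exact: sub0seq.
rewrite -[w]cats0; apply: cat_subseq; last exact: sub0seq.
by apply: (@subseq_rep B) => // z; rewrite el.
Qed.

Lemma reaches_words n p r : reaches p r ->
  exists u v, [/\ walk p.1 u r.1, walk p.2 v r.2 & sim n u v].
Proof.
elim=> {r} [|q r _ [u [v [wu wv s]]] [a t1 t2]|q r _ [u [v [wu wv s]]]].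
- by exists [::], [::].
- exists (u ++ [:: a]), (v ++ [:: a]); split; last exact: sim_cat.
    by apply/walk_cat; exists q.1 => //=; exists r.1.
  by apply/walk_cat; exists q.2 => //=; exists r.2.
case=> B [s' [l1 l2 [c1 c2] [d1 d2]]].
have [u' w1 h1] := jump_word n l1 c1 d1.
have [v' w2 h2] := jump_word n l2 c2 d2.
exists (u ++ u'), (v ++ v'); split; [by apply/walk_cat; exists q.1 | by apply/walk_cat; exists q.2 |].
apply: sim_cat => // w le; apply/idP/idP => [/(h1 w le)|/(h2 w le)] sub.
  exact/(h2 w le).
exact/(h1 w le).
Qed.

End Automaton.
End Subwords.

(* Splitting on one distinguishing subword at a time yields the Boolean combination. *)
Lemma separable_of_distinguished k (W : seq (seq 'I_k)) (L1 L2 : seq 'I_k -> Prop) :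
  (forall u v, L1 u -> L2 v -> exists2 w, w \in W & subseq w u != subseq w v) ->
  PT_separable L1 L2.
Proof.
elim: W L1 L2 => [|w W IHW] L1 L2 H.
  case: (classic (exists u, L1 u)) => [[u u1]|no1].
    exists (PPiece [::]); split=> [v _|v v2] /=; first by rewrite sub0seq.
    by case: (H _ _ u1 v2).
  exists (PNot (PPiece [::])); split=> [v v1|v _] /=; first by case: no1; exists v.
  by rewrite sub0seq.
have [b|e1 [p1 q1]] := IHW (fun u => L1 u /\ subseq w u) (fun u => L2 u /\ subseq w u).
  move=> v [u1 wu] [v2 wv]; case: (H _ _ u1 v2) => w'.
  by rewrite inE => /orP[/eqP->|]; [rewrite wu wv | exists w'].
have [b|e2 [p2 q2]] := IHW (fun u => L1 u /\ ~~ subseq w u) (fun u => L2 u /\ ~~ subseq w u).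
  move=> v [u1 wu] [v2 wv]; case: (H _ _ u1 v2) => w'.
  by rewrite inE => /orP[/eqP->|]; [rewrite (negbTE wu) (negbTE wv) | exists w'].
exists (POr (PAnd (PPiece w) e1) (PAnd (PNot (PPiece w)) e2)).
split=> v Lv /=; case wv: (subseq w v) => /=; rewrite ?orbF.
- by apply: p1.
- by apply: p2; rewrite wv.
- by apply: q1.
by apply: q2; rewrite wv.
Qed.

(** * Separability and unreachability *)

Fixpoint piece_length k (e : ptexpr k) : nat :=
  match e with
  | PPiece w => size w
  | PNot e1 => piece_length e1
  | POr e1 e2 | PAnd e1 e2 => maxn (piece_length e1) (piece_length e2)
  end.

Lemma pt_eval_sim k (e : ptexpr k) n u v :
  piece_length e <= n -> sim n u v -> pt_eval e u = pt_eval e v.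
Proof.
move=> + s; elim: e => [w|e IH|e1 IH1 e2 IH2|e1 IH1 e2 IH2] /=; first by move/s.
- by move/IH->.
- by rewrite geq_max => /andP[/IH1-> /IH2->].
by rewrite geq_max => /andP[/IH1-> /IH2->].
Qed.

Lemma separable_iff_unreachable k (Q : finType) (tr : Q -> 'I_k -> Q -> bool)
    (I1 F1 I2 F2 : pred Q) (L1 L2 : seq 'I_k -> Prop) :
  (forall w, L1 w <-> exists p q, [/\ I1 p, F1 q & walk tr p w q]) ->
  (forall w, L2 w <-> exists p q, [/\ I2 p, F2 q & walk tr p w q]) ->
  PT_separable L1 L2 <->
  ~ exists p r, [/\ I1 p.1, I2 p.2, reaches tr p r & F1 r.1 /\ F2 r.2].
Proof.
move=> L1E L2E; split=> [[e [e1 e2]] [p [r [i1 i2 R [f1 f2]]]]|no].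
  have [u [v [wu wv s]]] := reaches_words (piece_length e) R.
  have /e1 : L1 u by apply/L1E; exists p.1, r.1.
  have /e2 : L2 v by apply/L2E; exists p.2, r.2.
  by rewrite (pt_eval_sim (leqnn _) s) => /negbTE->.
(* Every word lies in the ideal A^*; the successor gives the strict bound on its weight required by
   [sim_common_match]. *)
pose n := (weight #|Q| [:: inr [set: 'I_k]]).+1.
apply: (@separable_of_distinguished k (words _ n)) => u v Lu Lv.
case: (classic (sim n u v)) => [s|ns].
  have Iu : ideal [:: inr [set: 'I_k]] u.
    by rewrite -[u]cats0; apply: ideal_stars (ideal_nil _) => x; rewrite inE.
  have [ps [mu mv]] := sim_common_match (leqnn _) s Iu.
  case/L1E: Lu => p1 [r1 [i1 f1 w1]]; case/L2E: Lv => p2 [r2 [i2 f2 w2]].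
  case: no; exists (p1, p2), (r1, r2); split=> //.
  exact: matches_reaches (leqnn _) mu mv w1 w2.
case: (boolP (has (fun w => subseq w u != subseq w v) (words _ n))) => [/hasP[w]|/hasPn H].
  by exists w.
by case: ns => w /(mem_words)/H /negPn/eqP.
Qed.


(** * Bounded-loop programs and their compilation *)

Inductive expr : Type :=
  | EConst of nat
  | EPar of nat
  | EVar of nat
  | EAdd of expr & expr
  | ESub of expr & expr
  | EArr of nat & expr
  | ESum of nat & nat & expr.

Inductive stmt : Type :=
  | SStore of nat & expr & expr
  | SSeq of stmt & stmt
  | SFor of nat & nat & stmt.

Definition store := nat -> nat -> nat.
Definition upd_store (A : store) (j i v : nat) : store :=
  fun j' i' => if (j' == j) && (i' == i) then v else A j' i'.

Section Semantics.
Variable par : nat -> nat.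

Fixpoint eval (A : store) (env : Defs.mem) (e : expr) : nat :=
  match e with
  | EConst c => c
  | EPar p => par p
  | EVar x => env x
  | EAdd e1 e2 => eval A env e1 + eval A env e2
  | ESub e1 e2 => eval A env e1 - eval A env e2
  | EArr j e1 => A j (eval A env e1)
  | ESum x p e1 => \sum_(0 <= i < par p) eval A (upd env x i) e1
  end.

Fixpoint sem (env : Defs.mem) (s : stmt) (A : store) : store :=
  match s with
  | SStore j e1 e2 => upd_store A j (eval A env e1) (eval A env e2)
  | SSeq s1 s2 => sem env s2 (sem env s1 A)
  | SFor x p s1 => foldl (fun A i => sem (upd env x i) s1 A) A (iota 0 (par p))
  end.

End Semantics.

(* Variables are de Bruijn levels: a binder at depth [d] must bind variable [d]. *)
Fixpoint wfE d (e : expr) : bool :=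
  match e with
  | EConst _ => true
  | EPar p => p < 4
  | EVar x => x < d
  | EAdd e1 e2 | ESub e1 e2 => wfE d e1 && wfE d e2
  | EArr j e1 => (j < 8) && wfE d e1
  | ESum x p e1 => [&& x == d, d < 10, p < 4 & wfE d.+1 e1]
  end.

(** Height of the evaluation stack: a right operand is computed one register higher, while the left
    value waits below it. *)
Fixpoint temps (e : expr) : nat :=
  match e with
  | EConst _ | EPar _ | EVar _ => 0
  | EAdd e1 e2 | ESub e1 e2 => maxn (temps e1) (temps e2).+1
  | EArr _ e1 | ESum _ _ e1 => (temps e1).+1
  end.

Fixpoint wfS d (s : stmt) : bool :=
  match s with
  | SStore j e1 e2 => [&& j < 8, wfE d e1, wfE d e2, temps e1 < 19 & temps e2 < 19]
  | SSeq s1 s2 => wfS d s1 && wfS d s2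
  | SFor x p s1 => [&& x == d, d < 10, p < 4 & wfS d.+1 s1]
  end.

(* Register layout: 2 holds 0, 3 holds 1, 4 holds the address D of the arrays, 5-8 the
   parameters, 10-19 the loop variables, 20-39 temporaries.  Cell [i] of array [j < 8]
   is at D + 8 i + j, so the arrays are unbounded and disjoint.  A jump is [IJz 2]. *)
Definition addr_code r j :=
  [:: IAdd r r r; IAdd r r r; IAdd r r r; IConst r.+1 j; IAdd r r r.+1; IAdd r r 4].

(** [r] receives the value; [b] is the address at which the code is placed, needed because jump
    targets are absolute. *)
Fixpoint compE (e : expr) (r b : nat) : seq instr :=
  match e with
  | EConst c => [:: IConst r c]
  | EPar p => [:: IAdd r (5 + p) 2]
  | EVar x => [:: IAdd r (10 + x) 2]
  | EAdd e1 e2 => let c1 := compE e1 r b in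
      c1 ++ compE e2 r.+1 (b + size c1) ++ [:: IAdd r r r.+1]
  | ESub e1 e2 => let c1 := compE e1 r b in
      c1 ++ compE e2 r.+1 (b + size c1) ++ [:: ISub r r r.+1]
  | EArr j e1 => compE e1 r b ++ addr_code r j ++ [:: ILoad r r]
  | ESum x p e1 => let c := compE e1 r.+1 (b + 4) in
      [:: IConst r 0; IConst (10 + x) 0; ISub r.+1 (5 + p) (10 + x);
          IJz r.+1 (b + size c + 7)]
      ++ c ++ [:: IAdd r r r.+1; IAdd (10 + x) (10 + x) 3; IJz 2 (b + 2)]
  end.

Fixpoint compS (s : stmt) (b : nat) : seq instr :=
  match s with
  | SStore j e1 e2 => let c1 := compE e1 20 b ++ addr_code 20 j in
      c1 ++ compE e2 21 (b + size c1) ++ [:: IStore 20 21]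
  | SSeq s1 s2 => let c1 := compS s1 b in c1 ++ compS s2 (b + size c1)
  | SFor x p s1 => let c := compS s1 (b + 3) in
      [:: IConst (10 + x) 0; ISub 20 (5 + p) (10 + x); IJz 20 (b + size c + 5)]
      ++ c ++ [:: IAdd (10 + x) (10 + x) 3; IJz 2 (b + 1)]
  end.

(** [X] stands for a bound on all parameters, hence on the number of rounds of every loop; the
    constants count the instructions around the body. *)
Fixpoint costE X (e : expr) : nat :=
  match e with
  | EConst _ | EPar _ | EVar _ => 1
  | EAdd e1 e2 | ESub e1 e2 => costE X e1 + costE X e2 + 1
  | EArr _ e1 => costE X e1 + 7
  | ESum _ _ e1 => X * (costE X e1 + 5) + 4
  end.

Fixpoint costS X (s : stmt) : nat :=
  match s with
  | SStore _ e1 e2 => costE X e1 + costE X e2 + 7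
  | SSeq s1 s2 => costS X s1 + costS X s2
  | SFor _ _ s1 => X * (costS X s1 + 4) + 3
  end.

Lemma upd_same M i v : upd M i v i = v. Proof. by rewrite /upd eqxx. Qed.
Lemma upd_other M i v j : j != i -> upd M i v j = M j.
Proof. by rewrite /upd => /negbTE->. Qed.

(** * Correctness and cost of the compiler *)

Section Compilation.
Variable P : seq instr.

Definition exec c c' T := exists2 t, t <= T & iter t (step P) c = c'.

Lemma exec_refl c : exec c c 0. Proof. by exists 0. Qed.

Lemma exec_trans c1 c2 c3 T1 T2 :
  exec c1 c2 T1 -> exec c2 c3 T2 -> exec c1 c3 (T1 + T2).
Proof.
move=> [t1 le1 <-] [t2 le2 <-]; exists (t2 + t1); last by rewrite iterD.
by rewrite addnC leq_add.
Qed.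

Definition stepI (ins : instr) pc (M : Defs.mem) : config :=
  match ins with
  | IConst i v => (pc.+1, upd M i v)
  | IAdd i j l => (pc.+1, upd M i (M j + M l))
  | ISub i j l => (pc.+1, upd M i (M j - M l))
  | ILoad i j => (pc.+1, upd M i (M (M j)))
  | IStore i j => (pc.+1, upd M (M i) (M j))
  | IJz i t => (if M i == 0 then t else pc.+1, M)
  | IHalt => (pc, M)
  end.

Lemma exec_instr ins pc M c T :
  nth IHalt P pc = ins -> exec (stepI ins pc M) c T -> exec (pc, M) c T.+1.
Proof.
by move=> <- [t le e]; exists t.+1 => //; rewrite iterSr; exact: e.
Qed.

Lemma exec_weaken c pc pc' M T T' :
  exec c (pc, M) T -> pc = pc' -> T <= T' -> exec c (pc', M) T'.
Proof. by move=> [t le e] <- le'; exists t => //; apply: leq_trans le le'. Qed.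

Definition codeat b l := forall i, i < size l -> nth IHalt P (b + i) = nth IHalt l i.

Lemma codeat_cat b l1 l2 : codeat b (l1 ++ l2) -> codeat b l1 /\ codeat (b + size l1) l2.
Proof.
move=> H; split=> i lt; first by rewrite H ?nth_cat ?lt // size_cat ltn_addr.
by rewrite -addnA H ?size_cat ?ltn_add2l // nth_cat ltnNge leq_addr /= addKn.
Qed.

Lemma codeat_cons b ins l : codeat b (ins :: l) -> nth IHalt P b = ins /\ codeat b.+1 l.
Proof.
move=> H; split=> [|i lt]; first by have := H 0; rewrite addn0 => ->.
by rewrite addSnnS H.
Qed.

(** Loop variables and temporaries are left out, so that code changing only these preserves the
    relation. *)
Record rep par (A : store) (M : Defs.mem) : Prop := Rep {
  rep_zero : M 2 = 0;
  rep_one : M 3 = 1;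
  rep_base : 40 <= M 4;
  rep_par : forall p, p < 4 -> M (5 + p) = par p;
  rep_arr : forall j i, j < 8 -> M (M 4 + (8 * i + j)) = A j i }.

(** Only the loop variables of depth at least [d] and the temporaries from [r] upwards may
    change. *)
Definition frame d r (M M' : Defs.mem) :=
  forall c, (c < 10 + d) || (20 <= c < r) || (40 <= c) -> M' c = M c.

Lemma frame_trans d r M1 M2 M3 : frame d r M1 M2 -> frame d r M2 M3 -> frame d r M1 M3.
Proof. by move=> f g c h; rewrite g ?f. Qed.

Lemma frame_weaken d r d' r' M M' : d' <= d -> r' <= r ->
  frame d r M M' -> frame d' r' M M'.
Proof. by move=> le1 le2 f c h; apply: f; lia. Qed.

Lemma frame_upd d r c v M : (10 + d <= c < 20) || (r <= c < 40) -> 20 <= r -> d <= 10 ->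
  frame d r M (upd M c v).
Proof. by move=> h lr ld c' h'; rewrite /upd; case: eqP => // ?; lia. Qed.

Lemma rep_frame par A d r M M' : rep par A M -> frame d r M M' -> rep par A M'.
Proof.
move=> [z o b p a] f; have low c : c < 10 -> M' c = M c by move=> lt; apply: f; lia.
split; rewrite ?low //; first by move=> q lt; rewrite low ?p //; lia.
by move=> j i lt; rewrite -a // f //; lia.
Qed.

Lemma addr_code_ok par A b r j M :
  codeat b (addr_code r j) -> 20 <= r -> rep par A M -> r < 39 ->
  exists M', [/\ exec (b, M) (b + size (addr_code r j), M') 6, M' r = M 4 + (8 * M r + j) & frame 10 r M M'].
Proof.
move=> /codeat_cons[h1 /codeat_cons[h2 /codeat_cons[h3 /codeat_cons[h4
  /codeat_cons[h5 /codeat_cons[h6 _]]]]]] lr R lr'.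
eexists; split.
- do 6 (apply: exec_instr; first eassumption); rewrite /stepI.
  by apply: exec_weaken (exec_refl _) _ _; rewrite //= ; lia.
- by rewrite /upd; repeat (case: eqP => ? //; try lia); lia.
by move=> c h; rewrite /upd; repeat (case: eqP => ? //; try lia).
Qed.

Variable X : nat.

Lemma compE_ok par A e r b d env M :
  codeat b (compE e r b) -> wfE d e -> d <= 10 -> 20 <= r -> r + temps e < 40 ->
  rep par A M -> (forall x, x < d -> M (10 + x) = env x) ->
  (forall p, p < 4 -> par p <= X) ->
  exists M', [/\ exec (b, M) (b + size (compE e r b), M') (costE X e),
                 M' r = eval par A env e & frame d r M M'].
Proof.
elim: e r b d env M => [c|p|x|e1 IH1 e2 IH2|e1 IH1 e2 IH2|j e IH|x p e IH] r b d env M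
  C wf ld lr lt R V lX.
- have [h _] := codeat_cons C.
  eexists; split; first by apply: (exec_instr h); apply: exec_weaken (exec_refl _) _ _ => /=; lia.
    by rewrite /upd eqxx.
  by apply: frame_upd; lia.
- have [h _] := codeat_cons C.
  eexists; split; first by apply: (exec_instr h); apply: exec_weaken (exec_refl _) _ _ => /=; lia.
    by rewrite /upd eqxx (rep_zero R) (rep_par R) ?addn0.
  by apply: frame_upd; lia.
- have [h _] := codeat_cons C.
  eexists; split; first by apply: (exec_instr h); apply: exec_weaken (exec_refl _) _ _ => /=; lia.
    by rewrite /upd eqxx (rep_zero R) V ?addn0.
  by apply: frame_upd; lia.
- move: C => /= /codeat_cat[C1 /codeat_cat[C2 /codeat_cons[h _]]].
  move: wf lt => /= /andP[wf1 wf2] lt.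
  have [|M1 [E1 v1 f1]] := IH1 _ _ d env M C1 wf1 ld lr _ R V lX; first lia.
  have [|||M2 [E2 v2 f2]] := IH2 _ _ d env M1 C2 wf2 ld _ _ (rep_frame R f1) _ lX; try lia.
    by move=> y ly; rewrite f1 ?V //; lia.
  eexists; split.
  + apply: exec_weaken (exec_trans E1 (exec_trans E2 (exec_instr h (exec_refl _)))) _ _ => //.
      by rewrite !size_cat /=; lia.
    by lia.
  + by rewrite /upd eqxx v2 f2 ?v1 //; lia.
  apply: frame_trans f1 (frame_trans (frame_weaken _ _ f2) (frame_upd _ _ _ _ _)); lia.
- move: C => /= /codeat_cat[C1 /codeat_cat[C2 /codeat_cons[h _]]].
  move: wf lt => /= /andP[wf1 wf2] lt.
  have [|M1 [E1 v1 f1]] := IH1 _ _ d env M C1 wf1 ld lr _ R V lX; first lia.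
  have [|||M2 [E2 v2 f2]] := IH2 _ _ d env M1 C2 wf2 ld _ _ (rep_frame R f1) _ lX; try lia.
    by move=> y ly; rewrite f1 ?V //; lia.
  eexists; split.
  + apply: exec_weaken (exec_trans E1 (exec_trans E2 (exec_instr h (exec_refl _)))) _ _ => //.
      by rewrite !size_cat /=; lia.
    by lia.
  + by rewrite /upd eqxx v2 f2 ?v1 //; lia.
  apply: frame_trans f1 (frame_trans (frame_weaken _ _ f2) (frame_upd _ _ _ _ _)); lia.
- have {}C : codeat b (compE e r b ++ addr_code r j ++ [:: ILoad r r]) := C.
  move: C => /codeat_cat[C1 /codeat_cat[C2 /codeat_cons[h _]]].
  move: wf lt => /= /andP[lj wf1] lt.
  have [|M1 [E1 v1 f1]] := IH _ _ d env M C1 wf1 ld lr _ R V lX; first lia.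
  have R1 := rep_frame R f1.
  have [|M2 [E2 v2 f2]] := addr_code_ok C2 lr R1; first lia.
  have R2 := rep_frame R1 f2.
  eexists; split.
  + apply: exec_weaken (exec_trans E1 (exec_trans E2 (exec_instr h (exec_refl _)))) _ _ => //.
    by rewrite !size_cat /=; lia.
  + by rewrite /upd eqxx v2 v1 -(f2 4) // (rep_arr R2).
  apply: frame_trans f1 (frame_trans (frame_weaken _ _ f2) (frame_upd _ _ _ _ _)); lia.
move: C wf lt => /= C /and4P[/eqP xd d10 p4 wf] lt; subst x.
move: C => /codeat_cons[h1 /codeat_cons[h2 /codeat_cons[h3 /codeat_cons[h4]]]].
set c := compE e r.+1 (b + 4) => /codeat_cat[C /codeat_cons[h5 /codeat_cons[h6 /codeat_cons[h7 _]]]].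
(* Loop invariant at the test: [i] rounds are done, [m] remain, and register [r] holds the partial
   sum. *)
have loop m i M1 : i + m = par p -> M1 r = \sum_(0 <= k < i) eval par A (upd env d k) e ->
    M1 (10 + d) = i -> frame d r M M1 ->
    exists M', [/\ exec (b.+2, M1) (b + size c + 7, M') (m * (costE X e + 5) + 2),
      M' r = \sum_(0 <= k < par p) eval par A (upd env d k) e & frame d r M M'].
  elim: m i M1 => [|m IHm] i M1 em er ei f1.
    eexists; split.
    + apply: (exec_instr h3); rewrite /stepI; apply: (exec_instr h4); rewrite /stepI.
      rewrite [upd _ _ _ r.+1]/upd eqxx.
      have R1 := rep_frame R f1.
      rewrite (rep_par R1) // ei; have -> : par p - i == 0 by lia.
      by apply: exec_weaken (exec_refl _) _ _.
    + rewrite upd_other ?er; last lia.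
      by congr (\sum_(0 <= k < _) _); lia.
    by apply: frame_trans f1 (frame_upd _ _ _ _ _); lia.
  have R1 := rep_frame R f1.
  pose M2 := upd M1 r.+1 (M1 (5 + p) - M1 (10 + d)).
  have f2 : frame 10 r.+1 M1 M2 by apply: frame_upd; lia.
  have C' : codeat (b + 4) c by rewrite (_ : b + 4 = b.+4) ?addn4.
  have [|||M3 [E3 v3 f3]] :=
      IH _ _ d.+1 (upd env d i) M2 C' wf d10 _ _ (rep_frame R1 f2) _ lX; try lia.
    move=> y ly; rewrite /M2 /upd; case: eqP => [|_]; first lia.
    case: eqP => [->//|?]; by rewrite f1 ?V //; lia.
  have v3r : M3 r = M1 r by rewrite f3 ?f2 //; lia.
  have v3x : M3 (10 + d) = i by rewrite f3 ?f2 ?ei //; lia.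
  have R3 := rep_frame (rep_frame R1 f2) f3.
  pose M4 := upd M3 r (M3 r + M3 r.+1).
  pose M5 := upd M4 (10 + d) (M4 (10 + d) + M4 3).
  have f4 : frame d r M3 M4 by apply: frame_upd; lia.
  have f5 : frame d r M4 M5 by apply: frame_upd; lia.
  have R5 := rep_frame (rep_frame R3 f4) f5.
  have [||||M6 [E6 v6 f6]] := IHm i.+1 M5.
  + lia.
  + rewrite /M5 upd_other; last lia.
    by rewrite /M4 upd_same v3 big_nat_recr //= v3r er.
  + rewrite /M5 upd_same /M4 !upd_other; try lia.
    by rewrite (rep_one R3) v3x addn1.
  + apply: frame_trans f1 (frame_trans (frame_weaken _ _ f2) (frame_trans (frame_weaken _ _ f3) (frame_trans f4 f5))); lia.
  exists M6; split=> //.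
  apply: (exec_weaken (T := (costE X e + (3 + (m * (costE X e + 5) + 2))).+2)) (erefl _) _; last by rewrite mulSn; lia.
  apply: (exec_instr h3); rewrite /stepI -/M2; apply: (exec_instr h4); rewrite /stepI.
  have -> : (M2 r.+1 == 0) = false.
    by rewrite /M2 /upd eqxx (rep_par R1) // ei; lia.
  have {}E3 : exec (b.+4, M2) (b.+4 + size c, M3) (costE X e) by rewrite -(addn4 b).
  apply: exec_trans E3 _.
  apply: (exec_instr h5); rewrite /stepI -/M4; apply: (exec_instr h6); rewrite /stepI -/M5.
  apply: (exec_instr h7); rewrite /stepI (rep_zero R5) /= addn2.
  exact: E6.
pose M0 := upd (upd M r 0) (10 + d) 0.
have [||||M' [E' v' f']] := loop (par p) 0 M0.
- by [].
- by rewrite big_nil /M0 upd_other ?upd_same //; lia.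
- by rewrite /M0 upd_same.
- by apply: frame_trans (frame_upd _ _ _ _ _) (frame_upd _ _ _ _ _); lia.
exists M'; split=> //.
apply: (exec_weaken (T := (par p * (costE X e + 5) + 2).+2)).
- by apply: (exec_instr h1); rewrite /stepI; apply: (exec_instr h2); exact: E'.
- by rewrite size_cat /=; lia.
by have := lX _ p4; nia.
Qed.

Lemma compS_ok par A s b d env M :
  codeat b (compS s b) -> wfS d s -> d <= 10 ->
  rep par A M -> (forall x, x < d -> M (10 + x) = env x) ->
  (forall p, p < 4 -> par p <= X) ->
  exists M', [/\ exec (b, M) (b + size (compS s b), M') (costS X s),
                 rep par (sem par env s A) M' & forall c, c < 10 + d -> M' c = M c].
Proof.
elim: s A b d env M => [j e1 e2|s1 IH1 s2 IH2|x p s IH] A b d env M C wf ld R V lX.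
- have {}C : codeat b ((compE e1 20 b ++ addr_code 20 j) ++
      compE e2 21 (b + size (compE e1 20 b ++ addr_code 20 j)) ++ [:: IStore 20 21]) := C.
  move: C => /codeat_cat[/codeat_cat[C1 Ca] /codeat_cat[C2 /codeat_cons[h _]]].
  move: wf; case/and5P=> lj wf1 wf2 t1 t2.
  have [||M1 [E1 v1 f1]] := compE_ok C1 wf1 ld _ _ R V lX; try lia.
  have R1 := rep_frame R f1.
  have [||M2 [E2 v2 f2]] := addr_code_ok Ca _ R1; try lia.
  have R2 := rep_frame R1 f2.
  have [|||M3 [E3 v3 f3]] := compE_ok (env := env) C2 wf2 ld _ _ R2 _ lX; try lia.
    by move=> x lx; rewrite f2 ?f1 ?V //; lia.
  have R3 := rep_frame R2 f3.
  have a3 : M3 20 = M3 4 + (8 * eval par A env e1 + j).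
    by rewrite (f3 20) ?v2 ?v1 ?(f3 4) ?(f2 4) //; lia.
  eexists; split.
  + rewrite -[b + size _ + _]addnA -size_cat in E2.
    apply: exec_weaken (exec_trans E1 (exec_trans E2 (exec_trans E3 (exec_instr h (exec_refl _))))) _ _.
      by rewrite !size_cat /=; lia.
    by rewrite /=; lia.
  + have b3 := rep_base R3.
    split; rewrite /upd a3.
    * by case: eqP => ?; [lia | apply: rep_zero R3].
    * by case: eqP => ?; [lia | apply: rep_one R3].
    * by case: eqP => ?; [lia | ].
    * by move=> p lp; case: eqP => ?; [lia | apply: rep_par R3 _ lp].
    move=> j' i' lj'; case: (4 =P _) => [|_]; first lia.
    rewrite v3 /= /upd_store; case: eqP => [e|ne].
      have [-> ->] : j' = j /\ i' = eval par A env e1 by lia.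
      by rewrite !eqxx.
    case: (j' =P j) => [ej|_] /=; last exact: rep_arr R3 _ _ lj'.
    case: (i' =P _) => [ei|_] /=; last exact: rep_arr R3 _ _ lj'.
    by case: ne; rewrite ej ei.
  move=> c lc; rewrite /= /upd a3; have := rep_base R3.
  by case: eqP => [|_ _]; [lia | rewrite f3 ?f2 ?f1 //; lia].
- move: C wf => /= /codeat_cat[C1 C2] /andP[wf1 wf2].
  have [M1 [E1 R1 f1]] := IH1 A b d env M C1 wf1 ld R V lX.
  have [|M2 [E2 R2 f2]] := IH2 _ _ d env M1 C2 wf2 ld R1 _ lX.
    by move=> x lx; rewrite f1 ?V //; lia.
  exists M2; split=> //; last by move=> c lc; rewrite f2 ?f1.
  by apply: exec_weaken (exec_trans E1 E2) _ _; rewrite ?size_cat ?addnA.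
move: C wf => /= C /and4P[/eqP xd d10 p4 wf]; subst x.
move: C => /codeat_cons[h1 /codeat_cons[h2 /codeat_cons[h3]]].
set c := compS s (b + 3) => /codeat_cat[C /codeat_cons[h4 /codeat_cons[h5 _]]].
(* Invariant at the test: the memory represents the store reached so far, and folding over the
   remaining [m] indices gives the final one. *)
have loop m i A1 M1 : i + m = par p -> rep par A1 M1 ->
    M1 (10 + d) = i -> (forall c, c < 10 + d -> M1 c = M c) ->
    exists M', [/\ exec (b.+1, M1) (b + size c + 5, M') (m * (costS X s + 4) + 2),
      rep par (foldl (fun A i => sem par (upd env d i) s A) A1 (iota i m)) M'
      & forall c, c < 10 + d -> M' c = M c].
  elim: m i A1 M1 => [|m IHm] i A1 M1 em R1 ei f1.
    pose M2 := upd M1 20 (M1 (5 + p) - M1 (10 + d)).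
    have f2 : frame 10 20 M1 M2 by apply: frame_upd; lia.
    exists M2; split.
    + apply: (exec_instr h2); rewrite /stepI -/M2; apply: (exec_instr h3); rewrite /stepI.
      have -> : M2 20 == 0 by rewrite /M2 upd_same (rep_par R1) // ei; lia.
      by apply: exec_weaken (exec_refl _) _ _.
    + exact: rep_frame R1 f2.
    by move=> k lk; rewrite f2 ?f1 //; lia.
  pose M2 := upd M1 20 (M1 (5 + p) - M1 (10 + d)).
  have f2 : frame 10 20 M1 M2 by apply: frame_upd; lia.
  have R2 := rep_frame R1 f2.
  have C' : codeat (b + 3) c by rewrite addn3.
  have [|M3 [E3 R3 f3]] := IH A1 _ d.+1 (upd env d i) M2 C' wf d10 R2 _ lX.
  + move=> y ly; rewrite f2; last lia.
    by rewrite /upd; case: eqP => [->//|?]; rewrite f1 ?V //; lia.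
  pose M5 := upd M3 (10 + d) (M3 (10 + d) + M3 3).
  have f5 : frame d 20 M3 M5 by apply: frame_upd; lia.
  have R5 := rep_frame R3 f5.
  have [|||M6 [E6 R6 f6]] := IHm i.+1 _ M5 _ R5.
  + lia.
  + by rewrite /M5 /upd eqxx (rep_one R3) f3 ?f2 ?ei ?addn1 //; lia.
  + by move=> k lk; rewrite f5 ?f3 ?f2 ?f1 //; lia.
  exists M6; split=> //.
  apply: (exec_weaken (T := (costS X s + (2 + (m * (costS X s + 4) + 2))).+2)) (erefl _) _; last by rewrite mulSn; lia.
  apply: (exec_instr h2); rewrite /stepI -/M2; apply: (exec_instr h3); rewrite /stepI.
  have -> : (M2 20 == 0) = false.
    by rewrite /M2 /upd eqxx (rep_par R1) // ei; lia.
  have {}E3 : exec (b.+3, M2) (b.+3 + size c, M3) (costS X s) by rewrite -(addn3 b).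
  apply: exec_trans E3 _.
  apply: (exec_instr h4); rewrite /stepI -/M5.
  apply: (exec_instr h5); rewrite /stepI (rep_zero R5) /= addn1.
  exact: E6.
pose M0 := upd M (10 + d) 0.
have f0 : frame d 20 M M0 by apply: frame_upd; lia.
have [||||M' [E' R' f']] := loop (par p) 0 A M0.
- by [].
- exact: rep_frame R f0.
- by rewrite /M0 /upd eqxx.
- by move=> k lk; rewrite f0 //; lia.
exists M'; split=> //.
apply: (exec_weaken (T := (par p * (costS X s + 4) + 2).+1)).
- by apply: (exec_instr h1); exact: E'.
- by rewrite size_cat /=; lia.
by have := lX _ p4; nia.
Qed.

End Compilation.

(** * Polynomial bounds *)

(** Positive arguments make powers monotone in the exponent, which closure under sums relies on; the
    bound is applied at n1+n2+k+1. *)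
Definition poly (f : nat -> nat) := exists c d, forall x, 0 < x -> f x <= c * x ^ d.

Lemma poly_const a : poly (fun=> a).
Proof. by exists a, 0 => x _; rewrite expn0 muln1. Qed.

Lemma poly_id : poly id. Proof. by exists 1, 1 => x _; rewrite expn1 mul1n. Qed.

Lemma poly_add f g : poly f -> poly g -> poly (fun x => f x + g x).
Proof.
move=> [c1 [d1 H1]] [c2 [d2 H2]]; exists (c1 + c2), (d1 + d2) => x x0.
rewrite mulnDl; apply: leq_add.
  by apply: leq_trans (H1 x x0) _; rewrite leq_mul2l leq_pexp2l ?orbT ?leq_addr.
by apply: leq_trans (H2 x x0) _; rewrite leq_mul2l leq_pexp2l ?orbT ?leq_addl.
Qed.

Lemma poly_mul f g : poly f -> poly g -> poly (fun x => f x * g x).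
Proof.
move=> [c1 [d1 H1]] [c2 [d2 H2]]; exists (c1 * c2), (d1 + d2) => x x0.
by rewrite expnD mulnACA leq_mul ?H1 ?H2.
Qed.

Lemma poly_costE e : poly (fun X => costE X e).
Proof.
elim: e => *; try exact: poly_const; do ?[apply: poly_add | apply: poly_mul] => //;
  by [exact: poly_const | exact: poly_id].
Qed.

Lemma poly_costS s : poly (fun X => costS X s).
Proof.
elim: s => *; do ?[apply: poly_add | apply: poly_mul] => //;
  by [exact: poly_const | exact: poly_id | exact: poly_costE].
Qed.


(** * Relocating the input *)

(* The input of size s occupies cells 0..s.  Cell i goes to D + 8 i, where D = 2 s + 40;
   cells 1-39, which become registers, are saved first, with only cells 0 and 1 as workspace:
   cell 1 is parked at address 2 s until the increment 8 fits in it. *)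
Definition save_code i m := flatten [seq [:: IAdd 0 0 1; IStore 0 j] | j <- iota i m].

Definition prologue : seq instr :=
  [:: IAdd 0 0 0; IStore 0 1; IConst 1 56; IAdd 0 0 1; IStore 0 2; ISub 2 0 1;
      ILoad 2 2; IConst 1 8; ISub 0 0 1; IStore 0 2; IAdd 0 0 1]
  ++ save_code 3 37 ++
  [:: IConst 1 312; ISub 4 0 1; IConst 2 0; IConst 3 1; IConst 10 40; IConst 1 40;
      ISub 11 4 1; IAdd 11 11 3; IConst 12 8; IAdd 13 0 12;
      IAdd 14 10 10; ISub 14 11 14; IJz 14 103; ILoad 15 10; IStore 13 15;
      IAdd 10 10 3; IAdd 13 13 12; IJz 2 95;
      IConst 5 0; IConst 6 0; IConst 7 0; IConst 8 0].

Section Prologue.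
Variable P : seq instr.

Lemma exec_const pc M i v c T : nth IHalt P pc = IConst i v ->
  exec P (pc.+1, upd M i v) c T -> exec P (pc, M) c T.+1.
Proof. by move=> h; apply: exec_instr h. Qed.

Lemma exec_add pc M i j l a b c T : nth IHalt P pc = IAdd i j l -> M j = a -> M l = b ->
  exec P (pc.+1, upd M i (a + b)) c T -> exec P (pc, M) c T.+1.
Proof. by move=> h <- <-; apply: exec_instr h. Qed.

Lemma exec_sub pc M i j l a b c T : nth IHalt P pc = ISub i j l -> M j = a -> M l = b ->
  exec P (pc.+1, upd M i (a - b)) c T -> exec P (pc, M) c T.+1.
Proof. by move=> h <- <-; apply: exec_instr h. Qed.

Lemma exec_load pc M i j a v c T : nth IHalt P pc = ILoad i j -> M j = a -> M a = v ->
  exec P (pc.+1, upd M i v) c T -> exec P (pc, M) c T.+1.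
Proof. by move=> h <- <-; apply: exec_instr h. Qed.

Lemma exec_store pc M i j a v c T : nth IHalt P pc = IStore i j -> M i = a -> M j = v ->
  exec P (pc.+1, upd M a v) c T -> exec P (pc, M) c T.+1.
Proof. by move=> h <- <-; apply: exec_instr h. Qed.

Lemma exec_jz pc M i t a c T : nth IHalt P pc = IJz i t -> M i = a ->
  exec P (if a == 0 then t else pc.+1, M) c T -> exec P (pc, M) c T.+1.
Proof. by move=> h <-; apply: exec_instr h. Qed.

Variable inp : seq nat.
Let s := size inp.
Let D := 2 * s + 40.
Let I := init_mem inp.
Hypothesis s_gt2 : 2 < s.

Ltac lookup := rewrite /upd; repeat (case: eqP => ?; try lia); try done; try lia.

(** The targets D + 8i lie beyond both the input and cell 39, so no cell still to be saved is
    overwritten. Cell 0 starts 8 too low because each round increments it before storing. *)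
Lemma save_ok m i b M :
  codeat P b (save_code i m) -> 3 <= i -> i + m <= 40 ->
  M 0 = D + 8 * i - 8 -> M 1 = 8 ->
  (forall c, 2 < c -> c <= s -> M c = I c) ->
  (forall c, 0 < c < i -> c <= s -> M (D + 8 * c) = I c) ->
  exists M', [/\ exec P (b, M) (b + 2 * m, M') (2 * m),
     M' 0 = D + 8 * (i + m) - 8,
     (forall c, 2 < c -> c <= s -> M' c = I c)
   & (forall c, 0 < c < i + m -> c <= s -> M' (D + 8 * c) = I c)].
Proof.
elim: m i b M => [|m IHm] i b M C li lim e0 e1 eI eD.
  by exists M; rewrite !addn0; split=> //; apply: exec_refl.
have [h1 /codeat_cons[h2 C']] := codeat_cons C.
pose M' := upd (upd M 0 (D + 8 * i - 8 + 8)) (D + 8 * i) (M i).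
have [||||||M2 [E2 r0 rI rD]] := IHm i.+1 b.+2 M' C'.
- lia.
- lia.
- by rewrite /M'; lookup.
- by rewrite /M'; lookup.
- by move=> c c2 cs; rewrite /M' -eI //; lookup.
- move=> c ci cs; rewrite /M'; case: (eqVneq c i) => [e|ne].
    by rewrite e upd_same eI //; lia.
  by rewrite -eD; lookup.
exists M2; split=> //; try by rewrite -addSnnS.
- apply: (exec_weaken (T := (2 * m).+2)) (erefl _) _; last lia.
  apply: (exec_add h1 e0 e1); apply: (exec_store h2).
  + by instantiate (1 := D + 8 * i); rewrite upd_same; lia.
  + by instantiate (1 := M i); lookup.
  by apply: exec_weaken E2 _ _; lia.
Qed.

(** The exit test i > s is made on doubles, as 2s+1-2i = 0: 2s is recovered as D - 40, whereas s
    itself has been destroyed. For an input that ends before cell 40 no round takes place. *)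
Lemma copy_ok m i M :
  codeat P 95 (drop 95 prologue) -> i + m = maxn s.+1 40 -> 40 <= i ->
  M 10 = i -> M 11 = 2 * s + 1 -> M 12 = 8 -> M 13 = D + 8 * i ->
  M 2 = 0 -> M 3 = 1 -> M 4 = D ->
  (forall c, 39 < c -> c <= s -> M c = I c) ->
  (forall c, 0 < c < i -> c <= s -> M (D + 8 * c) = I c) ->
  exists M', [/\ exec P (95, M) (103, M') (8 * m + 3),
     M' 2 = 0, M' 3 = 1, M' 4 = D
   & (forall c, 0 < c <= s -> M' (D + 8 * c) = I c)].
Proof.
move=> C; have [h0 /codeat_cons[h1 /codeat_cons[h2 /codeat_cons[h3 /codeat_cons[h4
  /codeat_cons[h5 /codeat_cons[h6 /codeat_cons[h7 _]]]]]]]] := codeat_cons C.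
elim: m i M => [|m IHm] i M em li e10 e11 e12 e13 e2 e3 e4 eI eD.
  pose M1 := upd (upd M 14 (i + i)) 14 (2 * s + 1 - (i + i)).
  exists M1; split; try by rewrite /M1; lookup.
    apply: (exec_add h0 e10 e10); apply: (exec_sub (a := 2 * s + 1) (b := i + i) h1); [by lookup..|].
    apply: (exec_jz (a := 0) h2); first by rewrite upd_same; lia.
    exact: exec_refl.
  by move=> c cs; rewrite /M1 -eD; [lookup | lia | lia].
pose M1 := upd (upd M 14 (i + i)) 14 (2 * s + 1 - (i + i)).
pose M2 := upd (upd M1 15 (I i)) (D + 8 * i) (I i).
pose M3 := upd (upd M2 10 (i + 1)) 13 (D + 8 * i + 8).
have [|||||||||||M4 [E4 f2 f3 f4 fD]] := IHm i.+1 M3.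
- lia.
- lia.
- by rewrite /M3 /M2 /M1; lookup.
- by rewrite /M3 /M2 /M1; lookup.
- by rewrite /M3 /M2 /M1; lookup.
- by rewrite /M3 /M2 /M1; lookup.
- by rewrite /M3 /M2 /M1; lookup.
- by rewrite /M3 /M2 /M1; lookup.
- by rewrite /M3 /M2 /M1; lookup.
- by move=> c c1 cs; rewrite -(eI c) // /M3 /M2 /M1; lookup.
- move=> c ci cs; rewrite /M3 /M2 /M1; case: (eqVneq c i) => [e|ne].
    by rewrite e; lookup.
  by rewrite -(eD c); [lookup | lia | lia].
exists M4; split=> //.
apply: (exec_weaken (T := (8 * m + 3).+4.+4)) (erefl _) _; last lia.
apply: (exec_add h0 e10 e10); apply: (exec_sub (a := 2 * s + 1) (b := i + i) h1); [by lookup..|].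
apply: (exec_jz (a := 2 * s + 1 - (i + i)) h2); first by rewrite upd_same.
have -> : (2 * s + 1 - (i + i) == 0) = false by lia.
apply: (exec_load (a := i) (v := I i) h3); [by lookup | by rewrite -(eI i); [lookup | lia | lia] |].
apply: (exec_store (a := D + 8 * i) (v := I i) h4); [by lookup | by lookup |].
apply: (exec_add (a := i) (b := 1) h5); [by lookup | by lookup |].
apply: (exec_add (a := D + 8 * i) (b := 8) h6); [by lookup | by lookup |].
by apply: (exec_jz (a := 0) h7); [by lookup |].
Qed.

Lemma prologue_ok : codeat P 0 prologue ->
  exists M A, [/\ exec P (0, I) (107, M) (8 * s + 102), rep (fun=> 0) A M
    & forall i, i < s -> A 0 i.+1 = nth 0 inp i].
Proof.
move=> C; have C95 : codeat P 95 (drop 95 prologue).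
  by move=> i li; rewrite nth_drop; apply: C; rewrite size_drop in li; lia.
have [C1 /codeat_cat[C2 C3]] := codeat_cat C.
case/codeat_cons: C1 => h0 /codeat_cons[h1 /codeat_cons[h2 /codeat_cons[h3 /codeat_cons[h4
  /codeat_cons[h5 /codeat_cons[h6 /codeat_cons[h7 /codeat_cons[h8 /codeat_cons[h9
  /codeat_cons[h10 _]]]]]]]]]].
(* [s + s] is where cell 1 is parked; [s + s + 48] and [s + s + 56] are D + 8 and D + 16, the final
   places of cells 1 and 2. *)
pose N1 := upd (upd (upd I 0 (s + s)) (s + s) (I 1)) 1 56.
pose N2 := upd (upd (upd N1 0 (s + s + 56)) (s + s + 56) (I 2)) 2 (s + s + 56 - 56).
pose N3 := upd (upd (upd N2 2 (I 1)) 1 8) 0 (s + s + 56 - 8).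
pose N4 := upd (upd N3 (s + s + 48) (I 1)) 0 (s + s + 48 + 8).
have E1 : exec P (0, I) (11, N4) 11.
  apply: (exec_add (a := s) (b := s) h0) => //.
  apply: (exec_store (a := s + s) (v := I 1) h1) => //.
  apply: (exec_const h2); rewrite -/N1.
  apply: (exec_add (a := s + s) (b := 56) h3); [by rewrite /N1; lookup..|].
  apply: (exec_store (a := s + s + 56) (v := I 2) h4); [by rewrite /N1; lookup.. |].
  apply: (exec_sub (a := s + s + 56) (b := 56) h5); [by rewrite /N1; lookup.. |].
  rewrite -/N2; apply: (exec_load (a := s + s) (v := I 1) h6); [by rewrite /N2 /N1; lookup.. |].
  apply: (exec_const h7).
  apply: (exec_sub (a := s + s + 56) (b := 8) h8); [by rewrite /N2 /N1; lookup.. |].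
  rewrite -/N3; apply: (exec_store (a := s + s + 48) (v := I 1) h9);
    [by rewrite /N3 /N2 /N1; lookup.. |].
  apply: (exec_add (a := s + s + 48) (b := 8) h10); [by rewrite /N3 /N2 /N1; lookup.. |].
  exact: exec_refl.
have [||||||M5 [E5 r0 rI rD]] := save_ok (M := N4) C2; try by [].
- by rewrite /N4 upd_same /D; lia.
- by rewrite /N4 /N3 /N2 /N1; lookup.
- by move=> c c2 cs; rewrite /N4 /N3 /N2 /N1; lookup.
- move=> c c3 cs; have [->|->] : c = 1 \/ c = 2 by lia.
    by rewrite /N4 /N3 /N2 /N1; lookup.
  by rewrite /N4 /N3 /N2 /N1; lookup.
case/codeat_cons: C3 => {}h0 /codeat_cons[{}h1 /codeat_cons[{}h2 /codeat_cons[{}h3 /codeat_cons[{}h4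
  /codeat_cons[{}h5 /codeat_cons[{}h6 /codeat_cons[{}h7 /codeat_cons[{}h8 /codeat_cons[{}h9 _]]]]]]]]].
pose K1 := upd (upd (upd (upd M5 1 312) 4 (D + 312 - 312)) 2 0) 3 1.
pose K2 := upd (upd (upd K1 10 40) 1 40) 11 (D - 40).
pose K3 := upd (upd (upd K2 11 (D - 40 + 1)) 12 8) 13 (D + 312 + 8).
have E6 : exec P (85, M5) (95, K3) 10.
  apply: (exec_const h0).
  apply: (exec_sub (a := D + 312) (b := 312) h1); [by lookup.. |].
  apply: (exec_const h2); apply: (exec_const h3); rewrite -/K1.
  apply: (exec_const h4); apply: (exec_const h5).
  apply: (exec_sub (a := D) (b := 40) h6); [by rewrite /K1; lookup.. |].
  rewrite -/K2; apply: (exec_add (a := D - 40) (b := 1) h7); [by rewrite /K2 /K1; lookup.. |].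
  apply: (exec_const h8).
  apply: (exec_add (a := D + 312) (b := 8) h9); [by rewrite /K2 /K1; lookup.. |].
  exact: exec_refl.
have [|||||||||||M7 [E7 z7 o7 b7 D7]] := copy_ok (m := maxn s.+1 40 - 40) (i := 40) (M := K3) C95;
  try by rewrite /K3 /K2 /K1; lookup.
- by move=> c c1 cs; rewrite /K3 /K2 /K1 -rI; [lookup | lia | lia].
- by move=> c c1 cs; rewrite /K3 /K2 /K1 -rD; [lookup | lia | lia].
have C103 : codeat P 103 (drop 103 prologue).
  by move=> i li; rewrite nth_drop; apply: C; rewrite size_drop in li; lia.
have [g0 /codeat_cons[g1 /codeat_cons[g2 /codeat_cons[g3 _]]]] := codeat_cons C103.
pose L := upd (upd (upd (upd M7 5 0) 6 0) 7 0) 8 0.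
have L4 : L 4 = D by rewrite /L; lookup.
(* The store is read off the memory. Nothing is claimed about the arrays other than 0, which the
   program must fill before reading. *)
exists L, (fun j i => L (L 4 + (8 * i + j))); split.
- apply: exec_weaken (exec_trans E1 (exec_trans E5 (exec_trans E6 (exec_trans E7
    (exec_const g0 (exec_const g1 (exec_const g2 (exec_const g3 (exec_refl _ _))))))))) _ _ => //.
  by lia.
- split=> //; try by rewrite /L; lookup.
  by case=> [|[|[|[|]]]].
move=> i li; rewrite L4 addn0 -[nth 0 inp i]/(I i.+1) -D7; last lia.
by rewrite /L; lookup.
Qed.

End Prologue.


(** * Reading the parameters and assembling the machine code *)

Definition set_param p e b := compE e 20 b ++ [:: IAdd (5 + p) 20 2].

(** Parameters start at 0 and are set one after the other, so each expression may use those set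
    before it. *)
Lemma set_param_ok P X par par' A p e b M :
  codeat P b (set_param p e b) -> p < 4 -> wfE 0 e -> temps e < 20 -> rep par A M ->
  (forall q, q < 4 -> par q <= X) ->
  (forall q, q < 4 -> par' q = if q == p then eval par A (fun=> 0) e else par q) ->
  exists M', exec P (b, M) (b + size (set_param p e b), M') (costE X e + 1) /\ rep par' A M'.
Proof.
move=> /codeat_cat[C /codeat_cons[h _]] lp wf lt R lX par'E.
have [||||M1 [E1 v1 f1]] := compE_ok (env := fun=> 0) C wf _ _ _ R _ lX; try by [].
have [z o ba pa ar] := rep_frame R f1.
exists (upd M1 (5 + p) (M1 20 + M1 2)); split.
  apply: exec_weaken (exec_trans E1 (exec_instr h (exec_refl _ _))) _ _ => //.
  by rewrite size_cat addnA addn1.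
split; rewrite ?upd_other //; try lia.
  move=> q lq; rewrite par'E // -pa // /upd v1 z addn0.
  by rewrite eqn_add2l.
by move=> j i lj; rewrite upd_other ?ar //; lia.
Qed.

(** The second size follows the first automaton, at cell 3 + n1 + n1 + n1 k n1; the product is
    spelled as a nested sum. *)
Definition n2_expr := EArr 0 (EAdd (EConst 3) (EAdd (EPar 1) (EAdd (EPar 1)
  (ESum 0 1 (ESum 1 0 (EPar 1)))))).

Definition program (s : stmt) (out : expr) : seq instr :=
  let b1 := size prologue in
  let c1 := set_param 0 (EArr 0 (EConst 1)) b1 in
  let b2 := b1 + size c1 in
  let c2 := set_param 1 (EArr 0 (EConst 2)) b2 in
  let b3 := b2 + size c2 in
  let c3 := set_param 2 n2_expr b3 in
  let b4 := b3 + size c3 in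
  let c4 := set_param 3 (EAdd (EPar 1) (EPar 2)) b4 in
  let b5 := b4 + size c4 in
  let c5 := compS s b5 in
  let b6 := b5 + size c5 in
  prologue ++ c1 ++ c2 ++ c3 ++ c4 ++ c5 ++ compE out 20 b6 ++ [:: IAdd 0 20 2; IHalt].

Definition params k n1 n2 : nat -> nat := nth 0 [:: k; n1; n2; n1 + n2].

Lemma run_halted P t T M M' pc :
  exec P (0, M) (pc, M') T -> T <= t -> nth IHalt P pc = IHalt ->
  iter t (step P) (0, M) = (pc, M').
Proof.
move=> [t0 le0 e] le h; have le' := leq_trans le0 le.
rewrite -(subnK le') iterD e; elim: (t - t0) => //= n ->.
by rewrite /= h.
Qed.

(** The cubic bound on the input size makes the linear cost of relocation polynomial in the
    parameters; everything else is covered by [costE] and [costS]. *)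
Theorem ram_realizes s out : wfS 0 s -> wfE 0 out -> temps out < 20 ->
  exists (P : seq instr) c d, forall inp k n1 n2, let t := c * (n1 + n2 + k + 1) ^ d in
    2 < size inp <= 9 * (n1 + n2 + k + 1) ^ 3 ->
    nth 0 inp 0 = k -> nth 0 inp 1 = n1 ->
    n1 + n1 + n1 * (k * n1) + 2 < size inp ->
    nth 0 inp (n1 + n1 + n1 * (k * n1) + 2) = n2 ->
    exists A : store, [/\ forall i, i < size inp -> A 0 i.+1 = nth 0 inp i,
      halts_within P t inp
    & output P t inp = eval (params k n1 n2) (sem (params k n1 n2) (fun=> 0) s A) (fun=> 0) out].
Proof.
move=> wfs wfo lto; have [P EP] : exists P, P = program s out by exists (program s out).
exists P.
pose T X := 8 * (9 * X ^ 3) + 102 + ((costE X (EArr 0 (EConst 1)) + 1) +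
  ((costE X (EArr 0 (EConst 2)) + 1) + ((costE X n2_expr + 1) +
  ((costE X (EAdd (EPar 1) (EPar 2)) + 1) + (costS X s + (costE X out + 1)))))).
have [c [d H]] : poly T.
  have p3 : poly (fun X => X ^ 3) by exists 1, 3 => x _; rewrite mul1n.
  repeat first [exact: poly_costE | exact: poly_costS | exact: p3 | exact: poly_const
               | apply: poly_add | apply: poly_mul].
exists c, d => inp k n1 n2 t /andP[s2 s9] ek en1 l2 en2.
have {}H := H (n1 + n2 + k + 1) (ltac:(lia)).
have C : codeat P 0 (program s out) by move=> i _; rewrite add0n EP.
rewrite -/t in H.
case/codeat_cat: C => C0 /codeat_cat[C1 /codeat_cat[C2 /codeat_cat[C3 /codeat_cat[C4
  /codeat_cat[C5 /codeat_cat[C6 /codeat_cons[h /codeat_cons[hh _]]]]]]]].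
have [M0 [A [E0 R0 Ainp]]] := prologue_ok s2 C0.
set X := n1 + n2 + k + 1 in s9 H.
have [|||||M1 [E1 R1]] := @set_param_ok P X _ (nth 0 [:: k]) _ _ _ _ _ C1 _ _ _ R0; try by [].
  by case=> [|[|[|[|]]]] //= _; rewrite Ainp //; lia.
have [|||||M2 [E2 R2]] := @set_param_ok P X _ (nth 0 [:: k; n1]) _ _ _ _ _ C2 _ _ _ R1; try by [].
- by case=> [|[|[|[|]]]] //= _; lia.
- by case=> [|[|[|[|]]]] //= _; rewrite Ainp //; lia.
have [|||||M3 [E3 R3]] := @set_param_ok P X _ (nth 0 [:: k; n1; n2]) _ _ _ _ _ C3 _ _ _ R2; try by [].
- by case=> [|[|[|[|]]]] //= _; lia.
- case=> [|[|[|[|]]]] //= _; rewrite !sum_nat_const_nat !subn0 -en2 -Ainp //.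
  by congr (A 0 _); lia.
have [|||||M4 [E4 R4]] := @set_param_ok P X _ (params k n1 n2) _ _ _ _ _ C4 _ _ _ R3; try by [].
- by case=> [|[|[|[|]]]] //= _; lia.
- by case=> [|[|[|[|]]]].
have lX : forall q, q < 4 -> params k n1 n2 q <= X.
  by rewrite /params /X; case=> [|[|[|[|]]]] //= _; lia.
have [||M5 [E5 R5 _]] := @compS_ok P X _ _ _ _ _ (fun=> 0) _ C5 wfs _ R4 _ lX; try by [].
have [||||M6 [E6 v6 f6]] := @compE_ok P X _ _ _ _ _ _ (fun=> 0) _ C6 wfo _ _ _ R5 _ lX; try by [].
have R6 := rep_frame R5 f6.
have E := exec_trans E0 (exec_trans E1 (exec_trans E2 (exec_trans E3 (exec_trans E4
  (exec_trans E5 (exec_trans E6 (exec_instr h (exec_refl _ _)))))))).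
have rt : iter t (step P) (0, init_mem inp) = _ := run_halted E _ hh.
exists A; split=> //; rewrite /halts_within /output /run /= rt; try by apply: leq_trans H; rewrite /T; lia.
  by rewrite /halted /= hh.
by rewrite /= v6 (rep_zero R6) addn0.
Qed.


(** * Tables *)

Section Tables.
Variable par : nat -> nat.
Implicit Types (A : store) (env : nat -> nat) (e : expr) (s : stmt).

Definition tv A env e : bool := 0 < eval par A env e.

Definition notE e := ESub (EConst 1) e.
(** De Morgan's law: addition is disjunction of truth values, and truncated subtraction from 1 is
    negation. *)
Definition conjE es := notE (foldr (fun e acc => EAdd acc (notE e)) (EConst 0) es).
Definition lessE e1 e2 := ESub e2 e1.
Definition equalE e1 e2 := notE (EAdd (ESub e1 e2) (ESub e2 e1)).

Lemma tv_not A env e : tv A env (notE e) = ~~ tv A env e.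
Proof. by rewrite /tv /=; lia. Qed.

Lemma tv_conj A env es : tv A env (conjE es) = all (tv A env) es.
Proof.
rewrite tv_not; elim: es => //= e es IHes.
by rewrite -IHes {1}/tv /= addn_gt0 -/(tv A env (notE e)) tv_not negb_or negbK andbC.
Qed.

Lemma tv_or A env e1 e2 : tv A env (EAdd e1 e2) = tv A env e1 || tv A env e2.
Proof. by rewrite /tv /= addn_gt0. Qed.

Lemma tv_lt A env e1 e2 : tv A env (lessE e1 e2) = (eval par A env e1 < eval par A env e2).
Proof. by rewrite /tv /= subn_gt0. Qed.

Lemma tv_eq A env e1 e2 : tv A env (equalE e1 e2) = (eval par A env e1 == eval par A env e2).
Proof. by rewrite tv_not /tv /=; lia. Qed.

Lemma tv_sum A env x p e :
  tv A env (ESum x p e) = [exists i : 'I_(par p), tv A (upd env x i) e].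
Proof.
rewrite /tv /= big_mkord lt0n sum_nat_eq0 negb_forall.
by apply: eq_existsb => i; rewrite /= lt0n.
Qed.

Lemma eval_ext A env env' d e : wfE d e -> (forall x, x < d -> env x = env' x) ->
  eval par A env e = eval par A env' e.
Proof.
elim: e d env env' => //= [x|e1 IH1 e2 IH2|e1 IH1 e2 IH2|j e IH|x p e IH] d env env'.
- by move=> lx /(_ _ lx).
- by case/andP=> w1 w2 E; rewrite (IH1 _ _ _ w1 E) (IH2 _ _ _ w2 E).
- by case/andP=> w1 w2 E; rewrite (IH1 _ _ _ w1 E) (IH2 _ _ _ w2 E).
- by case/andP=> _ w E; rewrite (IH _ _ _ w E).
case/and4P=> /eqP-> _ _ w E; apply: eq_bigr => i _; apply: (IH _ _ _ w) => y ly.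
by rewrite /upd; case: eqP => // ?; apply: E; lia.
Qed.

(** A Horner step in base n1+n2: summing the constant [e1] that many times multiplies it. The sum
    binds variable [d], so [e1] may use only variables below [d]. *)
Definition muladdE d e1 e2 := EAdd (ESum d 3 e1) e2.
Definition idx2 d e1 e2 := muladdE d e1 e2.
Definition idx3 d e1 e2 e3 := muladdE d (muladdE d.+1 e1 e2) e3.
Definition idx4 d e1 e2 e3 e4 := muladdE d (muladdE d.+1 (muladdE d.+2 e1 e2) e3) e4.

Lemma eval_ext_upd A env d d' e i : wfE d e -> d <= d' ->
  eval par A (upd env d' i) e = eval par A env e.
Proof. by move=> w le; apply: (eval_ext _ w) => x lx; rewrite upd_other //; lia. Qed.

Lemma eval_muladd A env d e1 e2 v : (forall i, eval par A (upd env d i) e1 = v) ->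
  eval par A env (muladdE d e1 e2) = v * par 3 + eval par A env e2.
Proof.
move=> H; rewrite /muladdE /=; congr (_ + _).
by rewrite (eq_bigr (fun=> v)) // sum_nat_const_nat subn0 mulnC.
Qed.

Section Index.
Variables (A : store) (env : nat -> nat) (d : nat) (e1 e2 e3 e4 : expr).
Hypotheses (w1 : wfE d e1) (w2 : wfE d e2) (w3 : wfE d e3).
Let N := par 3.
Let ev := eval par A env.

Lemma eval_idx2 : eval par A env (idx2 d e1 e2) = ev e1 * N + ev e2.
Proof. by apply: eval_muladd => i; apply: eval_ext_upd w1 _. Qed.

Lemma eval_idx3 : eval par A env (idx3 d e1 e2 e3) = (ev e1 * N + ev e2) * N + ev e3.
Proof.
apply: eval_muladd => i; rewrite (@eval_muladd _ _ _ _ _ (ev e1)) => [|i2].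
  by rewrite (eval_ext_upd _ _ _ w2).
by rewrite !(eval_ext_upd _ _ _ w1) //; lia.
Qed.

Lemma eval_idx4 :
  eval par A env (idx4 d e1 e2 e3 e4) = ((ev e1 * N + ev e2) * N + ev e3) * N + ev e4.
Proof.
apply: eval_muladd => i; rewrite (@eval_muladd _ _ _ _ _ (ev e1 * N + ev e2)) => [|i2].
  by rewrite (eval_ext_upd _ _ _ w3).
rewrite (@eval_muladd _ _ _ _ _ (ev e1)) => [|i3].
  by rewrite !(eval_ext_upd _ _ _ w2) //; lia.
by rewrite !(eval_ext_upd _ _ _ w1) //; lia.
Qed.

End Index.

(** * Loops that fill a table *)

Fixpoint reads j e : bool :=
  match e with
  | EConst _ | EPar _ | EVar _ => false
  | EAdd e1 e2 | ESub e1 e2 => reads j e1 || reads j e2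
  | EArr j' e1 => (j' == j) || reads j e1
  | ESum _ _ e1 => reads j e1
  end.

Definition agree_off j A A' := forall j' i, j' != j -> A' j' i = A j' i.

Lemma eval_agree j A A' env e : ~~ reads j e -> agree_off j A A' ->
  eval par A' env e = eval par A env e.
Proof.
move=> + ag; elim: e env => //= [e1 IH1 e2 IH2|e1 IH1 e2 IH2|j' e IH|x p e IH] env.
- by rewrite negb_or => /andP[r1 r2]; rewrite IH1 ?IH2.
- by rewrite negb_or => /andP[r1 r2]; rewrite IH1 ?IH2.
- by rewrite negb_or => /andP[r1 r2]; rewrite IH ?ag.
by move=> r; apply: eq_bigr => i _; rewrite IH.
Qed.

(* [S c v]: cell [c] of array [j] receives the value [v]. *)
Definition writes env s j A0 (S : nat -> nat -> Prop) := forall A, agree_off j A0 A ->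
  [/\ agree_off j A0 (sem par env s A),
      forall c v, S c v -> sem par env s A j c = v
    & forall c, (forall v, ~ S c v) -> sem par env s A j c = A j c].

Definition functional_rel (S : nat -> nat -> Prop) := forall c v v', S c v -> S c v' -> v = v'.

Lemma writes_store env j A0 e1 e2 : ~~ reads j e1 -> ~~ reads j e2 ->
  writes env (SStore j e1 e2) j A0
    (fun c v => c = eval par A0 env e1 /\ v = eval par A0 env e2).
Proof.
move=> r1 r2 A ag; rewrite /= (eval_agree _ r1 ag) (eval_agree _ r2 ag) /upd_store.
split=> [j' i ne|c v [-> ->]|c no]; first by rewrite (negbTE ne) ag.
  by rewrite !eqxx.
by rewrite eqxx; case: eqP => // ec; case: (no (eval par A0 env e2)).
Qed.

Lemma sem_for_inv (Inv : nat -> store -> Prop) env x p s A :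
  Inv 0 A -> (forall i A', i < par p -> Inv i A' -> Inv i.+1 (sem par (upd env x i) s A')) ->
  Inv (par p) (sem par env (SFor x p s) A).
Proof.
move=> I0 IS /=; suff H m i A' : i + m = par p -> Inv i A' ->
    Inv (par p) (foldl (fun A i => sem par (upd env x i) s A) A' (iota i m)).
  exact: (H (par p) 0).
elim: m i A' => [|m IHm] i A' e I; first by rewrite -e addn0.
by apply: IHm; [lia | apply: IS => //; lia].
Qed.

(** Functionality makes the order of the rounds irrelevant: a cell written again receives the same
    value, and any other cell is left as it was. *)
Lemma writes_for env x p s j A0 (S : nat -> nat -> nat -> Prop) :
  (forall i, i < par p -> writes (upd env x i) s j A0 (S i)) ->
  functional_rel (fun c v => exists2 i, i < par p & S i c v) ->
  writes env (SFor x p s) j A0 (fun c v => exists2 i, i < par p & S i c v).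
Proof.
move=> W fS A ag.
pose Inv n A' := [/\ agree_off j A0 A',
  forall c v i, i < n -> i < par p -> S i c v -> A' j c = v
  & forall c, (forall i v, i < par p -> ~ S i c v) -> A' j c = A j c].
have [||a w u] := @sem_for_inv Inv env x p s A; first by split.
  move=> i A' lt [a w u]; have [a1 w1 u1] := W i lt A' a; split=> // [c v i' lei lp Sv|c no].
    have [e|ne] := eqVneq i' i; first by apply: w1; rewrite -e.
    case: (classic (exists v', S i c v')) => [[v' Sv']|no].
      by rewrite (w1 _ _ Sv'); apply: (fS c); [exists i | exists i'].
    rewrite u1 => [|v' Sv']; last by case: no; exists v'.
    by apply: (w c v i') => //; lia.
  by rewrite u1 ?u // => v; apply: no.
split=> // [c v [i lt Sv]|c no]; first exact: (w c v i).
by apply: u => i v lt Sv; apply: (no v); exists i.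
Qed.

Lemma functional_sub (S S' : nat -> nat -> Prop) :
  (forall c v, S' c v -> S c v) -> functional_rel S -> functional_rel S'.
Proof. by move=> H f c v v' /H Sv /H Sv'; apply: f Sv Sv'. Qed.

(** Distinct index tuples address distinct cells. The leading digit is unrestricted, which is why
    tables indexed by a letter put the letter first. *)
Lemma muladd_inj N x y x' y' : y < N -> y' < N -> x * N + y = x' * N + y' -> x = x' /\ y = y'.
Proof.
move=> ly ly' e; have N0 : 0 < N by lia.
have ex : x = x'.
  by have := congr1 (divn^~ N) e; rewrite !divnMDl // (divn_small ly) (divn_small ly') !addn0.
by split=> //; move: e; rewrite ex; lia.
Qed.

Definition tab2 d j e := SFor d 3 (SFor d.+1 3
  (SStore j (idx2 d.+2 (EVar d) (EVar d.+1)) e)).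
Definition tab3 d j e := SFor d 0 (SFor d.+1 3 (SFor d.+2 3
  (SStore j (idx3 d.+3 (EVar d) (EVar d.+1) (EVar d.+2)) e))).
Definition tab4 d j e := SFor d 3 (SFor d.+1 3 (SFor d.+2 3 (SFor d.+3 3
  (SStore j (idx4 d.+4 (EVar d) (EVar d.+1) (EVar d.+2) (EVar d.+3)) e)))).

Ltac lookup := rewrite /upd; repeat (case: eqP => ?; try lia); try done; try lia.

(** As [e] does not read the array being filled, all entries refer to the old store; fixpoint rounds
    therefore go through a buffer array. *)
Lemma tab2_ok d j e env A : ~~ reads j e ->
  agree_off j A (sem par env (tab2 d j e) A) /\
  forall x y, x < par 3 -> y < par 3 ->
    sem par env (tab2 d j e) A j (x * par 3 + y) =
    eval par A (upd (upd env d x) d.+1 y) e.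
Proof.
move=> r; pose env' x y := upd (upd env d x) d.+1 y.
pose ix := idx2 d.+2 (EVar d) (EVar d.+1).
have idx x y : eval par A (env' x y) ix = x * par 3 + y.
  by rewrite eval_idx2 /=; [congr (_ * _ + _); rewrite /env'; lookup | lia..].
pose S c v := exists2 x, x < par 3 & exists2 y, y < par 3 &
  c = eval par A (env' x y) ix /\ v = eval par A (env' x y) e.
have fS : functional_rel S.
  move=> c v v' [x lx [y ly [-> ->]]] [x' lx' [y' ly' [+ ->]]].
  by rewrite !idx => /(muladd_inj ly ly')[-> ->].
have W : writes env (tab2 d j e) j A S.
  apply: (writes_for _ fS) => x lx; apply: writes_for => [y ly|].
    exact: writes_store.
  by apply: functional_sub fS => c v H; exists x.
have [//|a w _] := W A; split=> // x y lx ly; apply: w.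
by exists x => //; exists y => //; rewrite idx.
Qed.

Lemma tab3_ok d j e env A : ~~ reads j e ->
  agree_off j A (sem par env (tab3 d j e) A) /\
  forall x y z, x < par 0 -> y < par 3 -> z < par 3 ->
    sem par env (tab3 d j e) A j ((x * par 3 + y) * par 3 + z) =
    eval par A (upd (upd (upd env d x) d.+1 y) d.+2 z) e.
Proof.
move=> r; pose env' x y z := upd (upd (upd env d x) d.+1 y) d.+2 z.
pose ix := idx3 d.+3 (EVar d) (EVar d.+1) (EVar d.+2).
have idx x y z : eval par A (env' x y z) ix = (x * par 3 + y) * par 3 + z.
  by rewrite eval_idx3 /=; [congr ((_ * _ + _) * _ + _); rewrite /env'; lookup | lia..].
pose S c v := exists2 x, x < par 0 & exists2 y, y < par 3 & exists2 z, z < par 3 &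
  c = eval par A (env' x y z) ix /\ v = eval par A (env' x y z) e.
have fS : functional_rel S.
  move=> c v v' [x lx [y ly [z lz [-> ->]]]] [x' lx' [y' ly' [z' lz' [+ ->]]]].
  by rewrite !idx => /(muladd_inj lz lz')[/(muladd_inj ly ly')[-> ->] ->].
have W : writes env (tab3 d j e) j A S.
  apply: (writes_for _ fS) => x lx; apply: writes_for => [y ly|]; first apply: writes_for => [z lz|].
  - exact: writes_store.
  - by apply: functional_sub fS => c v H; exists x => //; exists y.
  by apply: functional_sub fS => c v H; exists x.
have [//|a w _] := W A; split=> // x y z lx ly lz; apply: w.
by exists x => //; exists y => //; exists z => //; rewrite idx.
Qed.

Lemma tab4_ok d j e env A : ~~ reads j e ->
  agree_off j A (sem par env (tab4 d j e) A) /\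
  forall x y z u, x < par 3 -> y < par 3 -> z < par 3 -> u < par 3 ->
    sem par env (tab4 d j e) A j (((x * par 3 + y) * par 3 + z) * par 3 + u) =
    eval par A (upd (upd (upd (upd env d x) d.+1 y) d.+2 z) d.+3 u) e.
Proof.
move=> r; pose env' x y z u := upd (upd (upd (upd env d x) d.+1 y) d.+2 z) d.+3 u.
pose ix := idx4 d.+4 (EVar d) (EVar d.+1) (EVar d.+2) (EVar d.+3).
have idx x y z u : eval par A (env' x y z u) ix = ((x * par 3 + y) * par 3 + z) * par 3 + u.
  by rewrite eval_idx4 /=; [congr (((_ * _ + _) * _ + _) * _ + _); rewrite /env'; lookup | lia..].
pose S c v := exists2 x, x < par 3 & exists2 y, y < par 3 & exists2 z, z < par 3 &
  exists2 u, u < par 3 & c = eval par A (env' x y z u) ix /\ v = eval par A (env' x y z u) e.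
have fS : functional_rel S.
  move=> c v v' [x lx [y ly [z lz [u lu [-> ->]]]]] [x' lx' [y' ly' [z' lz' [u' lu' [+ ->]]]]].
  by rewrite !idx => /(muladd_inj lu lu')[/(muladd_inj lz lz')[/(muladd_inj ly ly')[-> ->] ->] ->].
have W : writes env (tab4 d j e) j A S.
  apply: (writes_for _ fS) => x lx; apply: writes_for => [y ly|];
    first (apply: writes_for => [z lz|]; first apply: writes_for => [u lu|]).
  - exact: writes_store.
  - by apply: functional_sub fS => c v H; exists x => //; exists y => //; exists z.
  - by apply: functional_sub fS => c v H; exists x => //; exists y.
  by apply: functional_sub fS => c v H; exists x.
have [//|a w _] := W A; split=> // x y z u lx ly lz lu; apply: w.
by exists x => //; exists y => //; exists z => //; exists u => //; rewrite idx.
Qed.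

End Tables.


(** * Fixpoints on finite types *)

Definition saturate (T : finType) (e : rel T) (f : pred T) : pred T :=
  fun y => f y || [exists z, f z && e z y].

Lemma saturate_ext (T : finType) (e e' : rel T) (f f' : pred T) :
  e =2 e' -> f =1 f' -> saturate e f =1 saturate e' f'.
Proof.
by move=> ee ff y; rewrite /saturate ff; congr (_ || _); apply: eq_existsb => z; rewrite ff ee.
Qed.

Lemma iter_saturateP (T : finType) (e : rel T) (f : pred T) i y :
  reflect (exists x p, [/\ f x, path e x p, last x p = y & size p <= i])
          (iter i (saturate e) f y).
Proof.
elim: i y => [|i IHi] y /=.
  apply: (iffP idP) => [fy|[x [p [fx _ <-]]]]; first by exists y, [::].
  by rewrite leqn0 size_eq0 => /eqP->.
apply: (iffP orP) => [[/IHi[x [p [fx ep ly le]]]|/existsP[z /andP[/IHi[x [p [fx ep lz le]]] ez]]]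
  |[x [p]]].
- by exists x, p; split=> //; apply: leqW.
- by exists x, (rcons p y); rewrite rcons_path lz ep last_rcons size_rcons.
case/lastP: p => [|p z] [fx ep ly le]; first by left; apply/IHi; exists x, [::].
right; apply/existsP; exists (last x p); move: ep ly le.
rewrite rcons_path last_rcons size_rcons => /andP[ep ez] <- le.
by rewrite ez andbT; apply/IHi; exists x, p.
Qed.

(** A path without repeated vertices has fewer than [#|T|] edges, so [#|T|] rounds reach
    everything. *)
Lemma iter_saturate (T : finType) (e : rel T) (f : pred T) y :
  iter #|T| (saturate e) f y = [exists x, f x && connect e x y].
Proof.
apply/idP/existsP => [/iter_saturateP[x [p [fx ep ly _]]]|[x /andP[fx /connectP[p ep ly]]]].
  by exists x; rewrite fx; apply/connectP; exists p.
case/shortenP: ep ly => p' ep' up' _ ly.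
apply/iter_saturateP; exists x, p'; split=> //.
by apply: ltnW; apply: leq_trans (max_card (mem (x :: p'))); rewrite (card_uniqP up').
Qed.

(** Each round either is already stable or loses an element, so [#|T|] rounds stabilise;
    monotonicity of [F] does not enter. *)
Lemma iter_decreasing_fix (T : finType) (F : {set T} -> {set T}) :
  (forall S, F S \subset S) -> F (iter #|T| F setT) = iter #|T| F setT.
Proof.
move=> dec.
suff H i : F (iter i F setT) = iter i F setT \/ #|iter i F setT| + i <= #|T|.
  case: (H #|T|) => //; rewrite -[X in _ <= X]add0n leq_add2r leqn0 cards_eq0 => /eqP e.
  by apply/eqP; rewrite eqEsubset dec e sub0set.
elim: i => [|i IHi] /=; first by right; rewrite cardsT addn0.
case: IHi => [e|le]; first by left; rewrite !e.
case: (eqVneq (F (iter i F setT)) (iter i F setT)) => [e|ne]; first by left; rewrite !e.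
right; apply: leq_trans le; rewrite addnS ltn_add2r; apply: proper_card.
by rewrite properEneq ne dec.
Qed.

(** * Maximal common loop alphabets *)

Section GreatestLoops.
Variables (A Q : finType) (tr : Q -> A -> Q -> bool).

Definition edge (B : {set A}) : rel Q := fun x y => [exists a, (a \in B) && tr x a y].

Lemma connP B p q : conn tr B p q <-> connect (edge B) p q.
Proof.
split=> [[w]|/connectP[s + ->]].
  elim: w p => [|a w IHw] p sub /=; first by move->.
  case=> p' t wq; apply: connect_trans (IHw p' _ wq); last first.
    by move=> x xw; apply: sub; rewrite inE xw orbT.
  by apply/connect1/existsP; exists a; rewrite t sub ?mem_head.
elim: s p => [|r s IHs] p /=; first by exists [::].
case/andP=> /existsP[a /andP[aB t]] /IHs[w sub wq].
exists (a :: w) => [x|]; first by rewrite inE => /orP[/eqP->|/sub].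
by exists r.
Qed.

Lemma edge_sub (B B' : {set A}) : B \subset B' -> subrel (connect (edge B)) (connect (edge B')).
Proof.
move=> /subsetP sub; apply: connect_sub => x y /existsP[a /andP[aB t]].
by apply/connect1/existsP; exists a; rewrite t sub.
Qed.

Definition on_loop (B : {set A}) q a :=
  [exists x, exists y, [&& tr x a y, connect (edge B) q x & connect (edge B) y q]].

Lemma loopsP B q : loops tr B q <-> forall a, a \in B -> on_loop B q a.
Proof.
split=> L a /L.
  by case=> x [y [/connP c1 t /connP c2]]; apply/existsP; exists x; apply/existsP; exists y; apply/and3P.
by case/existsP=> x /existsP[y /and3P[t /connP c1 /connP c2]]; exists x, y.
Qed.

Definition loop_step (q : Q * Q) (B : {set A}) : {set A} :=
  [set a in B | on_loop B q.1 a && on_loop B q.2 a].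
Definition max_loop q := iter #|A| (loop_step q) setT.

Lemma max_loop_loops q : loops tr (max_loop q) q.1 /\ loops tr (max_loop q) q.2.
Proof.
have fixq : loop_step q (max_loop q) = max_loop q.
  by apply: iter_decreasing_fix => B; apply/subsetP => a; rewrite inE => /andP[].
by split; apply/loopsP => a; rewrite -{1}fixq inE => /and3P[].
Qed.

(** A common loop alphabet survives every round, because enlarging the allowed alphabet only adds
    connections. *)
Lemma max_loop_max q B : loops tr B q.1 -> loops tr B q.2 -> B \subset max_loop q.
Proof.
move=> /loopsP L1 /loopsP L2; rewrite /max_loop; elim: #|A| => [|i IHi] /=; first exact: subsetT.
have mono p a : on_loop B p a -> on_loop (iter i (loop_step q) setT) p a.
  case/existsP=> x /existsP[y /and3P[t c1 c2]]; apply/existsP; exists x; apply/existsP; exists y.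
  by rewrite t !(edge_sub IHi).
apply/subsetP => a aB; rewrite inE (subsetP IHi) //=.
by rewrite !mono ?L1 ?L2.
Qed.

(* Enlarging [B] to the largest alphabet of common loops at [q] preserves a jump. *)
Lemma jumpP p r : jump tr p r <-> exists q : Q * Q,
  [/\ connect (edge (max_loop q)) p.1 q.1, connect (edge (max_loop q)) p.2 q.2,
      connect (edge (max_loop q)) q.1 r.1 & connect (edge (max_loop q)) q.2 r.2].
Proof.
split=> [[B [q [l1 l2 [/connP c1 /connP c2] [/connP d1 /connP d2]]]]|[q [c1 c2 d1 d2]]].
  by exists q; split; apply: edge_sub (max_loop_max l1 l2) _ _ _.
by have [? ?] := max_loop_loops q; exists (max_loop q), q; split=> //; split; apply/connP.
Qed.

Definition jumpb (p r : Q * Q) := [exists q : Q * Q, let C := connect (edge (max_loop q)) in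
  [&& C p.1 q.1, C p.2 q.2, C q.1 r.1 & C q.2 r.2]].

Definition syncb (p r : Q * Q) := [exists a, tr p.1 a r.1 && tr p.2 a r.2].

Definition stepb : rel (Q * Q) := fun p r => syncb p r || jumpb p r.

Lemma jumpbP p r : reflect (jump tr p r) (jumpb p r).
Proof.
apply: (iffP existsP) => [[q /and4P[c1 c2 d1 d2]]|/jumpP[q [c1 c2 d1 d2]]].
  by apply/jumpP; exists q.
by exists q; apply/and4P.
Qed.

Lemma syncbP p r : reflect (sync tr p r) (syncb p r).
Proof.
apply: (iffP existsP) => [[a /andP[? ?]]|[a t1 t2]]; first by exists a.
by exists a; rewrite t1.
Qed.

Lemma reachesP p r : reaches tr p r <-> connect stepb p r.
Proof.
split=> [|/connectP[s + ->]].
  elim=> [|q r' _ c s|q r' _ c s]; first exact: connect0.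
    by apply: connect_trans c (connect1 _); apply/orP; left; apply/syncbP.
  by apply: connect_trans c (connect1 _); apply/orP; right; apply/jumpbP.
elim: s p => [|q s IHs] p /=; first by constructor.
case/andP=> st /IHs; apply: reaches_trans; case/orP: st => [/syncbP|/jumpbP] H.
  exact: reaches_sync (reaches_refl _ _) H.
exact: reaches_jump (reaches_refl _ _) H.
Qed.

End GreatestLoops.


(** * The input and the union automaton *)

Lemma nth_flatten_rows (T : Type) (x : T) m (ss : seq (seq T)) i j :
  all (fun s => size s == m) ss -> j < m ->
  nth x (flatten ss) (i * m + j) = nth x (nth [::] ss i) j.
Proof.
move=> + lj; elim: ss i => [|s ss IHss] i /=; first by rewrite !nth_nil.
case/andP=> /eqP es /IHss IH; rewrite nth_cat es.
case: i => [|i]; first by rewrite lj.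
by rewrite mulSn -addnA ltnNge leq_addr addKn IH.
Qed.

Lemma size_flatten_rows (T : Type) m (ss : seq (seq T)) :
  all (fun s => size s == m) ss -> size (flatten ss) = size ss * m.
Proof. by elim: ss => //= s ss IH /andP[/eqP es /IH e]; rewrite size_cat es e. Qed.

Lemma size_enc_set n (S : {set 'I_n}) : size (enc_set S) = n.
Proof. by rewrite size_map size_enum_ord. Qed.

Lemma nth_enc_set n (S : {set 'I_n}) (q : 'I_n) : nth 0 (enc_set S) q = (q \in S).
Proof. by rewrite (nth_map q) ?size_enum_ord // nth_ord_enum. Qed.

Section EncodedAutomaton.
Variables (k n : nat) (M : nfa k n).

Let row q := flatten [seq enc_set (nfa_trans M q a) | a <- enum 'I_k].

Let sets_ok q : all (fun s => size s == n) [seq enc_set (nfa_trans M q a) | a <- enum 'I_k].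
Proof. by apply/allP => s /mapP[a _ ->]; rewrite size_enc_set. Qed.

Let size_row q : size (row q) = k * n.
Proof. by rewrite (size_flatten_rows (sets_ok q)) size_map size_enum_ord. Qed.

Let rows_ok : all (fun s => size s == k * n) [seq row q | q <- enum 'I_n].
Proof. by apply/allP => s /mapP[q _ ->]; rewrite size_row. Qed.

Lemma size_enc_nfa : size (enc_nfa M) = n + n + n * (k * n) + 1.
Proof.
rewrite /= !size_cat !size_enc_set (size_flatten_rows rows_ok) size_map size_enum_ord; lia.
Qed.

Lemma nth_enc_init (q : 'I_n) : nth 0 (enc_nfa M) (1 + q) = (q \in nfa_init M).
Proof. by rewrite add1n /= nth_cat size_enc_set ltn_ord nth_enc_set. Qed.

Lemma nth_enc_final (q : 'I_n) : nth 0 (enc_nfa M) (1 + n + q) = (q \in nfa_final M).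
Proof.
rewrite -addnA add1n /= nth_cat size_enc_set ltnNge leq_addr addKn.
by rewrite nth_cat size_enc_set ltn_ord nth_enc_set.
Qed.

Lemma nth_enc_trans (p r : 'I_n) (a : 'I_k) :
  nth 0 (enc_nfa M) (1 + (n + n) + ((p * k + a) * n + r)) = (r \in nfa_trans M p a).
Proof.
rewrite -addnA add1n -addnA /= nth_cat size_enc_set ltnNge leq_addr addKn.
rewrite nth_cat size_enc_set ltnNge leq_addr addKn mulnDl -mulnA -addnA.
rewrite (nth_flatten_rows _ _ rows_ok); last first.
  by have := ltn_ord a; have := ltn_ord r; nia.
rewrite (nth_map p) ?size_enum_ord // nth_ord_enum.
rewrite (nth_flatten_rows _ _ (sets_ok p)) //.
by rewrite (nth_map a) ?size_enum_ord // nth_ord_enum nth_enc_set.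
Qed.

End EncodedAutomaton.

(** * The disjoint union automaton *)

Section Union.
Variables (k n1 n2 : nat) (M1 : nfa k n1) (M2 : nfa k n2).
Local Notation Q := 'I_(n1 + n2).

Definition union_trans (p : Q) (a : 'I_k) (r : Q) : bool :=
  match split p, split r with
  | inl p1, inl r1 => r1 \in nfa_trans M1 p1 a
  | inr p2, inr r2 => r2 \in nfa_trans M2 p2 a
  | _, _ => false
  end.
Definition on_left (S : {set 'I_n1}) (p : Q) := if split p is inl q then q \in S else false.
Definition on_right (S : {set 'I_n2}) (p : Q) := if split p is inr q then q \in S else false.

Lemma split_lshift (q : 'I_n1) : split (lshift n2 q) = inl q.
Proof. exact: (unsplitK (inl q)). Qed.

Lemma split_rshift (q : 'I_n2) : split (rshift n1 q) = inr q.
Proof. exact: (unsplitK (inr q)). Qed.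

Lemma foldl_reach k' n (M : nfa k' n) (S : {set 'I_n}) w q :
  reflect (exists2 p, p \in S & walk (fun p a r => r \in nfa_trans M p a) p w q)
    (q \in foldl (fun (S : {set 'I_n}) (a : 'I_k') => \bigcup_(q in S) nfa_trans M q a) S w).
Proof.
elim: w S => [|a w IHw] S /=.
  by apply: (iffP idP) => [?|[p ? <- //]]; exists q.
apply: (iffP (IHw _)) => [[p /bigcupP[p' p'S t] pq]|[p' p'S [p t pq]]].
  by exists p' => //; exists p.
by exists p => //; apply/bigcupP; exists p'.
Qed.

Lemma nfa_langP k' n (M : nfa k' n) w : nfa_lang M w <->
  exists p q, [/\ p \in nfa_init M, q \in nfa_final M &
                  walk (fun p a r => r \in nfa_trans M p a) p w q].
Proof.
split=> [/existsP[q /andP[/foldl_reach[p pi pq] qf]]|[p [q [pi qf pq]]]]; first by exists p, q.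
by apply/existsP; exists q; rewrite qf andbT; apply/foldl_reach; exists p.
Qed.

Lemma walk_lshift p w q :
  walk union_trans (lshift n2 p) w q <->
  exists2 q', q = lshift n2 q' & walk (fun p a r => r \in nfa_trans M1 p a) p w q'.
Proof.
elim: w p => [|a w IHw] p /=; first by split=> [<-|[q' -> -> //]]; exists p.
split=> [[r]|[q' eq [r t rq]]].
  rewrite /union_trans split_lshift; case: (splitP r) => // r1 er t.
  have -> : r = lshift n2 r1 by apply: val_inj.
  by case/IHw=> q' -> rq; exists q' => //; exists r1.
exists (lshift n2 r); first by rewrite /union_trans !split_lshift.
by apply/IHw; exists q'.
Qed.

Lemma walk_rshift p w q :
  walk union_trans (rshift n1 p) w q <->
  exists2 q', q = rshift n1 q' & walk (fun p a r => r \in nfa_trans M2 p a) p w q'.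
Proof.
elim: w p => [|a w IHw] p /=; first by split=> [<-|[q' -> -> //]]; exists p.
split=> [[r]|[q' eq [r t rq]]].
  rewrite /union_trans split_rshift; case: (splitP r) => // r1 er t.
  have -> : r = rshift n1 r1 by apply: val_inj.
  by case/IHw=> q' -> rq; exists q' => //; exists r1.
exists (rshift n1 r); first by rewrite /union_trans !split_rshift.
by apply/IHw; exists q'.
Qed.

Lemma lang_left w : nfa_lang M1 w <-> exists p q,
  [/\ on_left (nfa_init M1) p, on_left (nfa_final M1) q & walk union_trans p w q].
Proof.
split=> [/nfa_langP[p [q [pi qf pq]]]|[p [q []]]].
  exists (lshift n2 p), (lshift n2 q); rewrite /on_left !split_lshift; split=> //.
  by apply/walk_lshift; exists q.
rewrite {1}/on_left; case: (splitP p) => // p1 ep pi.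
have -> : p = lshift n2 p1 by apply: val_inj.
move=> qf /walk_lshift[q' eq pq]; apply/nfa_langP; exists p1, q'; split=> //.
by move: qf; rewrite eq /on_left split_lshift.
Qed.

Lemma lang_right w : nfa_lang M2 w <-> exists p q,
  [/\ on_right (nfa_init M2) p, on_right (nfa_final M2) q & walk union_trans p w q].
Proof.
split=> [/nfa_langP[p [q [pi qf pq]]]|[p [q []]]].
  exists (rshift n1 p), (rshift n1 q); rewrite /on_right !split_rshift; split=> //.
  by apply/walk_rshift; exists q.
rewrite {1}/on_right; case: (splitP p) => // p1 ep pi.
have -> : p = rshift n1 p1 by apply: val_inj.
move=> qf /walk_rshift[q' eq pq]; apply/nfa_langP; exists p1, q'; split=> //.
by move: qf; rewrite eq /on_right split_rshift.
Qed.

Lemma separable_iff_saturated :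
  PT_separable (nfa_lang M1) (nfa_lang M2) <->
  ~~ [exists r : Q * Q, [&& iter #|{: Q * Q}| (saturate (stepb union_trans))
        (fun p => on_left (nfa_init M1) p.1 && on_right (nfa_init M2) p.2) r,
      on_left (nfa_final M1) r.1 & on_right (nfa_final M2) r.2]].
Proof.
rewrite (separable_iff_unreachable lang_left lang_right); split=> [no|/existsPn no].
  apply/existsPn => r; apply/negP => /and3P[]; rewrite iter_saturate.
  case/existsP=> p /andP[/andP[i1 i2] /reachesP R] f1 f2.
  by case: no; exists p, r.
case=> p [r [i1 i2 /reachesP R [f1 f2]]]; have /negP[] := no r.
by rewrite f1 f2 andbT andbT iter_saturate; apply/existsP; exists p; rewrite i1 i2.
Qed.

End Union.


(** * The decision program *)

(* Parameters: 0 is k, 1 is n1, 2 is n2 and 3 is n1 + n2.  Arrays: 0 is the input, 1 the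
   alphabets [max_loop], 2 the edges labelled in them, 3 the closure of 2, 4 a buffer,
   5 the reachable pairs, 6 the pairs from which a loop can be entered. *)

Definition header2 d := EAdd (EConst 3) (EAdd (EPar 1) (EAdd (EPar 1)
  (ESum d 1 (ESum d.+1 0 (EPar 1))))).

Definition initE off x := EArr 0 (EAdd off (EAdd (EConst 1) x)).
Definition finalE off n x := EArr 0 (EAdd off (EAdd (EAdd (EConst 1) (EPar n)) x)).
(** The offset 1 + 2n skips the size and the two state sets; then comes (p k + a) n + r, with
    products as sums. [n] is the number of a parameter, and [off] the cell where the automaton
    starts. *)
Definition transE d off n p a r :=
  EArr 0 (EAdd off (EAdd (EAdd (EConst 1) (EAdd (EPar n) (EPar n)))
    (EAdd (ESum d n (EAdd (ESum d.+1 0 p) a)) r))).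

Definition leftE e := lessE e (EPar 1).
Definition shiftE e := ESub e (EPar 1).

(** For a state of the wrong side the table lookup reads a meaningless cell; the side tests in the
    conjunction make its value irrelevant. *)
Definition union_transE d p a r := EAdd
  (conjE [:: leftE p; leftE r; transE d (EConst 2) 1 p a r])
  (conjE [:: notE (leftE p); notE (leftE r);
     transE d (header2 d) 2 (shiftE p) a (shiftE r)]).

Definition on_init d x y := conjE [:: leftE x; initE (EConst 2) x;
  notE (leftE y); initE (header2 d) (shiftE y)].
Definition on_final d x y := conjE [:: leftE x; finalE (EConst 2) 1 x;
  notE (leftE y); finalE (header2 d) 2 (shiftE y)].

Local Notation V := EVar.
Definition get4 j d x y z u := EArr j (idx4 d x y z u).

(** For each pair (q1, q2) held in the first two indices: reachability along edges labelled in its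
    current alphabet, as n1+n2 rounds of [saturate] from the identity relation. *)
Definition closure_prog d :=
  SSeq (tab4 d 2 (ESum (d + 4) 0 (conjE
    [:: EArr 1 (idx3 (d + 5) (V (d + 4)) (V d) (V (d + 1)));
        union_transE (d + 5) (V (d + 2)) (V (d + 4)) (V (d + 3))])))
  (SSeq (tab4 d 3 (equalE (V (d + 2)) (V (d + 3))))
  (SFor d 3 (SSeq
    (tab4 d.+1 4 (EAdd (get4 3 (d + 5) (V (d + 1)) (V (d + 2)) (V (d + 3)) (V (d + 4)))
      (ESum (d + 5) 3 (conjE
        [:: get4 3 (d + 6) (V (d + 1)) (V (d + 2)) (V (d + 3)) (V (d + 5));
            get4 2 (d + 6) (V (d + 1)) (V (d + 2)) (V (d + 5)) (V (d + 4))]))))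
    (tab4 d.+1 3 (get4 4 (d + 5) (V (d + 1)) (V (d + 2)) (V (d + 3)) (V (d + 4))))))).

(* The states [q1], [q2] and the letter [a] are variables 2, 3 and 1. *)
Definition loopE q := ESum 4 3 (ESum 5 3 (conjE
  [:: union_transE 6 (V 4) (V 1) (V 5); get4 3 6 (V 2) (V 3) q (V 4);
      get4 3 6 (V 2) (V 3) (V 5) q])).

(** k rounds of [loop_step] from the full alphabet, for all pairs at once. The last closure serves
    the final alphabets. *)
Definition loops_prog :=
  SSeq (tab3 0 1 (EConst 1))
  (SSeq (SFor 0 0 (SSeq (closure_prog 1)
    (SSeq (tab3 1 4 (conjE [:: EArr 1 (idx3 4 (V 1) (V 2) (V 3)); loopE (V 2); loopE (V 3)]))
          (tab3 1 1 (EArr 4 (idx3 4 (V 1) (V 2) (V 3)))))))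
  (closure_prog 0)).

(** A jump is split at its loop: array 6 first collects the loop pairs that can be entered, then the
    pairs reached on leaving them. One sum over source and loop pair together would nest binders
    beyond the ten loop variables. *)
Definition reach_step_prog :=
  SSeq (tab2 2 6 (ESum 4 3 (ESum 5 3 (conjE [:: EArr 5 (idx2 6 (V 4) (V 5));
    get4 3 6 (V 2) (V 3) (V 4) (V 2); get4 3 6 (V 2) (V 3) (V 5) (V 3)]))))
  (SSeq (tab2 2 4 (EAdd (EArr 5 (idx2 4 (V 2) (V 3))) (EAdd
    (ESum 4 3 (ESum 5 3 (ESum 6 0 (conjE [:: EArr 5 (idx2 7 (V 4) (V 5));
      union_transE 7 (V 4) (V 6) (V 2); union_transE 7 (V 5) (V 6) (V 3)]))))
    (ESum 4 3 (ESum 5 3 (conjE [:: EArr 6 (idx2 6 (V 4) (V 5));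
      get4 3 6 (V 4) (V 5) (V 4) (V 2); get4 3 6 (V 4) (V 5) (V 5) (V 3)]))))))
  (tab2 2 5 (EArr 4 (idx2 4 (V 2) (V 3))))).

(** Loops are bounded by single parameters, so the (n1+n2)^2 rounds needed for pairs of states take
    two nested loops. *)
Definition decision_prog :=
  SSeq loops_prog (SSeq (tab2 0 5 (on_init 2 (V 0) (V 1))) (SFor 0 3 (SFor 1 3 reach_step_prog))).

Definition decision_output := notE (ESum 0 3 (ESum 1 3
  (conjE [:: EArr 5 (idx2 2 (V 0) (V 1)); on_final 2 (V 0) (V 1)]))).

Lemma decision_wf : [&& wfS 0 decision_prog, wfE 0 decision_output & temps decision_output < 20].
Proof. by vm_compute. Qed.

(** * Correctness of the decision program *)

Section Correctness.
Variables (k n1 n2 : nat) (M1 : nfa k n1) (M2 : nfa k n2).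
Local Notation Q := 'I_(n1 + n2).
Let par := params k n1 n2.
Let inp := enc_input M1 M2.
Variable A0 : store.
Hypothesis A0E : forall i, i < size inp -> A0 0 i.+1 = nth 0 inp i.
Implicit Types (A : store) (env : nat -> nat).
Local Notation tv := (tv par).
Local Notation tr := (union_trans M1 M2).

Definition has_input A := forall i, A 0 i = A0 0 i.

Lemma size_inp : size inp = 1 + (n1 + n1 + n1 * (k * n1) + 1) + (n2 + n2 + n2 * (k * n2) + 1).
Proof. by rewrite /inp /enc_input; cbn [size]; rewrite size_cat !size_enc_nfa add1n addSn. Qed.

(** Array cells are shifted by one against the input list, and the alphabet size comes first; hence
    the offset 2. *)
Lemma read_left A i : has_input A -> i < size (enc_nfa M1) -> A 0 (2 + i) = nth 0 (enc_nfa M1) i.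
Proof.
move=> H li; rewrite H A0E /inp /enc_input.
  by cbn [nth]; rewrite nth_cat li.
by cbn [size]; rewrite size_cat; lia.
Qed.

Lemma read_right A i : has_input A -> i < size (enc_nfa M2) ->
  A 0 (3 + (n1 + (n1 + n1 * (k * n1))) + i) = nth 0 (enc_nfa M2) i.
Proof.
move=> H li; rewrite H.
have -> : 3 + (n1 + (n1 + n1 * (k * n1))) + i = (size (enc_nfa M1) + i).+2.
  by rewrite size_enc_nfa; lia.
rewrite A0E /inp /enc_input.
  by cbn [nth]; rewrite nth_cat ltnNge leq_addr addKn.
by cbn [size]; rewrite size_cat; lia.
Qed.

Lemma eval_header2 A env d : eval par A env (header2 d) = 3 + (n1 + (n1 + n1 * (k * n1))).
Proof. by rewrite /= !sum_nat_const_nat !subn0. Qed.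

Lemma tv_left A env e (p : Q) : eval par A env e = p ->
  tv A env (leftE e) = (if split p is inl _ then true else false).
Proof. by move=> e1; rewrite tv_lt e1 /=; case: (splitP p). Qed.

Lemma tv_init A env d ex ey (x y : Q) : has_input A ->
  eval par A env ex = x -> eval par A env ey = y ->
  tv A env (on_init d ex ey) = on_left (nfa_init M1) x && on_right (nfa_init M2) y.
Proof.
move=> H vx vy; rewrite tv_conj /= tv_not (tv_left vx) (tv_left vy) andbT.
rewrite /on_left /on_right; move: vx vy.
case: (splitP x) => x' -> vx //=; case: (splitP y) => y' -> vy; rewrite ?andbF //=.
rewrite /tv /initE /shiftE; cbn [eval]; rewrite eval_header2 vx vy -[par 1]/n1 addKn.
rewrite read_left ?read_right ?nth_enc_init //; first (by do 2 case: (_ \in _));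
  by rewrite size_enc_nfa; have := ltn_ord x'; have := ltn_ord y'; lia.
Qed.

Lemma tv_final A env d ex ey (x y : Q) : has_input A ->
  eval par A env ex = x -> eval par A env ey = y ->
  tv A env (on_final d ex ey) = on_left (nfa_final M1) x && on_right (nfa_final M2) y.
Proof.
move=> H vx vy; rewrite tv_conj /= tv_not (tv_left vx) (tv_left vy) andbT.
rewrite /on_left /on_right; move: vx vy.
case: (splitP x) => x' -> vx //=; case: (splitP y) => y' -> vy; rewrite ?andbF //=.
rewrite /tv /finalE /shiftE; cbn [eval]; rewrite eval_header2 vx vy -[par 1]/n1 -[par 2]/n2 addKn.
rewrite read_left ?read_right ?nth_enc_final //; first (by do 2 case: (_ \in _));
  by rewrite size_enc_nfa; have := ltn_ord x'; have := ltn_ord y'; lia.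
Qed.

Lemma eval_trans A env d off n p a r : wfE d p -> wfE d a ->
  eval par A env (transE d off n p a r) =
  A 0 (eval par A env off + (1 + (par n + par n) +
    ((eval par A env p * k + eval par A env a) * par n + eval par A env r))).
Proof.
move=> wp wa; rewrite /transE; cbn [eval]; congr (A 0 (_ + (_ + (_ + _)))).
rewrite (eq_bigr (fun=> eval par A env p * k + eval par A env a)) => [|i _].
  by rewrite sum_nat_const_nat subn0 mulnC.
rewrite (eval_ext_upd _ _ _ _ wa) //; congr (_ + _).
rewrite (eq_bigr (fun=> eval par A env p)) => [|j _].
  by rewrite sum_nat_const_nat subn0 mulnC.
by rewrite !(eval_ext_upd _ _ _ _ wp) //; lia.
Qed.

Lemma tv_trans A env d ep ea er (p : Q) (a : 'I_k) (r : Q) : has_input A ->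
  wfE d ep -> wfE d ea ->
  eval par A env ep = p -> eval par A env ea = a -> eval par A env er = r ->
  tv A env (union_transE d ep ea er) = tr p a r.
Proof.
move=> H wp wa vp va vr; rewrite tv_or !tv_conj /= !tv_not (tv_left vp) (tv_left vr).
rewrite /union_trans !andbT; move: vp vr.
case: (splitP p) => p' -> vp //=; case: (splitP r) => r' -> vr; rewrite ?andbF ?orbF //=.
  rewrite /tv eval_trans // vp va vr -[par 1]/n1 read_left // ?nth_enc_trans.
    by case: (_ \in _).
  rewrite size_enc_nfa; have := ltn_ord p'; have := ltn_ord r'; have := ltn_ord a; nia.
rewrite /tv eval_trans //; last by rewrite /= wp; lia.
rewrite eval_header2 [eval _ _ _ (shiftE ep)]/= [eval _ _ _ (shiftE er)]/= vp vr va.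
rewrite -[par 1]/n1 -[par 2]/n2 !addKn read_right // ?nth_enc_trans.
  by case: (_ \in _).
rewrite size_enc_nfa; have := ltn_ord p'; have := ltn_ord r'; have := ltn_ord a; nia.
Qed.


Definition rd2 A j (x y : Q) : bool := 0 < A j (x * (n1 + n2) + y).
Definition rd3 A j (a : 'I_k) (x y : Q) : bool :=
  0 < A j ((a * (n1 + n2) + x) * (n1 + n2) + y).
Definition rd4 A j (q1 q2 x y : Q) : bool :=
  0 < A j (((q1 * (n1 + n2) + q2) * (n1 + n2) + x) * (n1 + n2) + y).

Lemma tv_rd2 A env j d e1 e2 (x y : Q) : wfE d e1 ->
  eval par A env e1 = x -> eval par A env e2 = y ->
  tv A env (EArr j (idx2 d e1 e2)) = rd2 A j x y.
Proof. by move=> w1 v1 v2; rewrite /tv; cbn [eval]; rewrite eval_idx2 ?v1 ?v2. Qed.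

Lemma tv_rd3 A env j d e1 e2 e3 (a : 'I_k) (x y : Q) : wfE d e1 -> wfE d e2 ->
  eval par A env e1 = a -> eval par A env e2 = x -> eval par A env e3 = y ->
  tv A env (EArr j (idx3 d e1 e2 e3)) = rd3 A j a x y.
Proof. by move=> w1 w2 v1 v2 v3; rewrite /tv; cbn [eval]; rewrite eval_idx3 ?v1 ?v2 ?v3. Qed.

Lemma tv_rd4 A env j d e1 e2 e3 e4 (q1 q2 x y : Q) : wfE d e1 -> wfE d e2 -> wfE d e3 ->
  eval par A env e1 = q1 -> eval par A env e2 = q2 ->
  eval par A env e3 = x -> eval par A env e4 = y ->
  tv A env (get4 j d e1 e2 e3 e4) = rd4 A j q1 q2 x y.
Proof.
by move=> w1 w2 w3 v1 v2 v3 v4; rewrite /tv /get4; cbn [eval]; rewrite eval_idx4 ?v1 ?v2 ?v3 ?v4.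
Qed.

Lemma rd2_tab A env d j e x y : ~~ reads j e ->
  rd2 (sem par env (tab2 d j e) A) j x y = tv A (upd (upd env d x) d.+1 y) e.
Proof.
by move=> r; have [_ w] := tab2_ok par d env A r; rewrite /rd2 /tv -(w x y (ltn_ord x) (ltn_ord y)).
Qed.

Lemma rd3_tab A env d j e a x y : ~~ reads j e ->
  rd3 (sem par env (tab3 d j e) A) j a x y = tv A (upd (upd (upd env d a) d.+1 x) d.+2 y) e.
Proof.
move=> r; have [_ w] := tab3_ok par d env A r.
by rewrite /rd3 /tv -(w a x y (ltn_ord a) (ltn_ord x) (ltn_ord y)).
Qed.

Lemma rd4_tab A env d j e q1 q2 x y : ~~ reads j e ->
  rd4 (sem par env (tab4 d j e) A) j q1 q2 x y =
  tv A (upd (upd (upd (upd env d q1) d.+1 q2) d.+2 x) d.+3 y) e.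
Proof.
move=> r; have [_ w] := tab4_ok par d env A r.
by rewrite /rd4 /tv -(w q1 q2 x y (ltn_ord q1) (ltn_ord q2) (ltn_ord x) (ltn_ord y)).
Qed.

Definition keep (js : seq nat) A A' := forall j i, j \in js -> A' j i = A j i.

Lemma keep_trans js A1 A2 A3 : keep js A1 A2 -> keep js A2 A3 -> keep js A1 A3.
Proof. by move=> h1 h2 j i lj; rewrite h2 ?h1. Qed.

Lemma keep_sub js js' A A' : {subset js' <= js} -> keep js A A' -> keep js' A A'.
Proof. by move=> sub h j i /sub; apply: h. Qed.

Lemma keep_off js j A A' : j \notin js -> agree_off j A A' -> keep js A A'.
Proof. by move=> nj h j' i lj; apply: h; apply: contraNneq nj => <-. Qed.

Lemma keep_tab2 js env A d j e : j \notin js -> ~~ reads j e ->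
  keep js A (sem par env (tab2 d j e) A).
Proof. by move=> nj /(tab2_ok par d env A)[h _]; apply: keep_off nj h. Qed.

Lemma keep_tab3 js env A d j e : j \notin js -> ~~ reads j e ->
  keep js A (sem par env (tab3 d j e) A).
Proof. by move=> nj /(tab3_ok par d env A)[h _]; apply: keep_off nj h. Qed.

Lemma keep_tab4 js env A d j e : j \notin js -> ~~ reads j e ->
  keep js A (sem par env (tab4 d j e) A).
Proof. by move=> nj /(tab4_ok par d env A)[h _]; apply: keep_off nj h. Qed.

Lemma rd2_keep js j A A' x y : keep js A A' -> j \in js -> rd2 A' j x y = rd2 A j x y.
Proof. by move=> h lj; rewrite /rd2 h. Qed.

Lemma rd3_keep js j A A' a x y : keep js A A' -> j \in js -> rd3 A' j a x y = rd3 A j a x y.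
Proof. by move=> h lj; rewrite /rd3 h. Qed.

Lemma rd4_keep js j A A' q1 q2 x y : keep js A A' -> j \in js ->
  rd4 A' j q1 q2 x y = rd4 A j q1 q2 x y.
Proof. by move=> h lj; rewrite /rd4 h. Qed.

Lemma input_keep js A A' : keep js A A' -> 0 \in js -> has_input A -> has_input A'.
Proof. by move=> h l0 H i; rewrite h. Qed.

Ltac lk := by rewrite /= /upd; repeat (case: eqP => ?; try lia).

Lemma sem_seq env s1 s2 A : sem par env (SSeq s1 s2) A = sem par env s2 (sem par env s1 A).
Proof. by []. Qed.

Lemma closure_ok d env A (B : Q -> Q -> {set 'I_k}) :
  has_input A -> (forall a q1 q2, rd3 A 1 a q1 q2 = (a \in B q1 q2)) ->
  keep [:: 0; 1; 5] A (sem par env (closure_prog d) A) /\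
  forall q1 q2 x y, rd4 (sem par env (closure_prog d) A) 3 q1 q2 x y =
    connect (edge tr (B q1 q2)) x y.
Proof.
move=> H BE; rewrite /closure_prog !sem_seq.
set A1 := sem par env (tab4 d 2 _) A.
set A2 := sem par env (tab4 d 3 _) A1.
set body := SSeq (tab4 d.+1 4 _) _.
have K1 : keep [:: 0; 1; 5] A A1 by apply: keep_tab4.
have K2 : keep [:: 0; 1; 2; 5] A1 A2 by apply: keep_tab4.
have E1 q1 q2 x y : rd4 A1 2 q1 q2 x y = edge tr (B q1 q2) x y.
  rewrite rd4_tab // tv_sum; apply: eq_existsb => a; rewrite tv_conj /= andbT.
  by congr (_ && _); [rewrite (@tv_rd3 _ _ _ _ _ _ _ a q1 q2) ?BE //; try lk; rewrite /=; lia
    | apply: tv_trans => //; try lk; rewrite /=; lia].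
have E2 q1 q2 x y : rd4 A2 3 q1 q2 x y = (y == x).
  rewrite rd4_tab // tv_eq eq_sym -val_eqE; congr (_ == _); lk.
(* After [i] rounds array 3 holds the states reachable from [x] by at most [i] edges; the edge table
   2 has to be kept throughout. *)
pose Inv i A' := keep [:: 0; 1; 2; 5] A1 A' /\
  forall q1 q2 x, rd4 A' 3 q1 q2 x =1 iter i (saturate (edge tr (B q1 q2))) (pred1 x).
suff [K I] : Inv (par 3) (sem par env (SFor d 3 body) A2).
  split; first by apply: keep_trans K1 _; apply: keep_sub K => j; rewrite !inE => /or3P[] ->; rewrite ?orbT.
  move=> q1 q2 x y; rewrite [LHS]I (_ : par 3 = #|{: Q}|); last by rewrite card_ord.
  rewrite iter_saturate; apply/existsP/idP => [[z /andP[/eqP-> //]]|c].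
  by exists x; rewrite /= eqxx.
apply: sem_for_inv => [|i A' li [K I]]; first by split=> // q1 q2 x y; rewrite E2.
rewrite /body sem_seq; set A3 := sem par _ (tab4 d.+1 4 _) A'.
have K3 : keep [:: 0; 1; 2; 5] A' A3 by apply: keep_tab4.
have K4 : keep [:: 0; 1; 2; 5] A3 (sem par (upd env d i) (tab4 d.+1 3
    (get4 4 (d + 5) (EVar (d + 1)) (EVar (d + 2)) (EVar (d + 3)) (EVar (d + 4)))) A3).
  exact: keep_tab4.
split; first exact: keep_trans K (keep_trans K3 K4).
move=> q1 q2 x y; rewrite rd4_tab // (@tv_rd4 _ _ _ _ _ _ _ _ q1 q2 x y); try lk; try (by rewrite /=; lia).
rewrite rd4_tab // tv_or tv_sum iterS.
rewrite -(@saturate_ext _ _ _ (rd4 A' 3 q1 q2 x) _ (fun _ _ => erefl) (I q1 q2 x)) /saturate.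
congr (_ || _); first by apply: tv_rd4; try lk; rewrite /=; lia.
apply: eq_existsb => z; rewrite tv_conj /= andbT.
rewrite (@tv_rd4 _ _ _ _ _ _ _ _ q1 q2 x z); try lk; try (by rewrite /=; lia).
rewrite (@tv_rd4 _ _ _ _ _ _ _ _ q1 q2 z y); try lk; try (by rewrite /=; lia).
by rewrite (@rd4_keep _ 2 _ _ _ _ _ _ K) // E1.
Qed.

Lemma tv_loopE A env (B : Q -> Q -> {set 'I_k}) j (a : 'I_k) (q1 q2 q : Q) :
  has_input A -> (forall q1 q2 x y, rd4 A 3 q1 q2 x y = connect (edge tr (B q1 q2)) x y) ->
  env 1 = a -> env 2 = q1 -> env 3 = q2 -> j < 4 -> env j = q ->
  tv A env (loopE (EVar j)) = on_loop tr (B q1 q2) q a.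
Proof.
move=> H C e1 e2 e3 lj ej; rewrite tv_sum; apply: eq_existsb => x.
rewrite tv_sum; apply: eq_existsb => y; rewrite tv_conj; cbn [all]; rewrite andbT.
have envj : upd (upd env 4 x) 5 y j = q by rewrite !upd_other //; lia.
by congr [&& _, _ & _]; [apply: tv_trans | rewrite -C; apply: tv_rd4 | rewrite -C; apply: tv_rd4];
  rewrite //=; lia.
Qed.

Lemma loops_ok env A : has_input A ->
  keep [:: 0] A (sem par env loops_prog A) /\
  forall q1 q2 x y, rd4 (sem par env loops_prog A) 3 q1 q2 x y =
    connect (edge tr (max_loop tr (q1, q2))) x y.
Proof.
move=> H; rewrite /loops_prog !sem_seq.
set A1 := sem par env (tab3 0 1 _) A; set body := SSeq (closure_prog 1) _.
have K1 : keep [:: 0] A A1 by apply: keep_tab3.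
pose Bs i q1 q2 := iter i (loop_step tr (q1, q2)) setT.
(* Array 1 follows the iteration defining [max_loop] round by round; arrays 2 to 4 are recomputed
   each time. *)
pose Inv i A' := keep [:: 0] A A' /\ forall a q1 q2, rd3 A' 1 a q1 q2 = (a \in Bs i q1 q2).
have [K2 E2] : Inv (par 0) (sem par env (SFor 0 0 body) A1).
  apply: (@sem_for_inv par Inv) => [|i A' li [K' E']].
    by split=> // a q1 q2; rewrite rd3_tab // inE.
  rewrite /body !sem_seq; have H' : has_input A' by apply: input_keep K' _ H.
  have [K2 C2] := closure_ok 1 (upd env 0 i) H' E'.
  set A2 := sem par _ (closure_prog 1) A' in K2 C2 *; set A3 := sem par _ (tab3 1 4 _) A2.
  have K3 : keep [:: 0; 1] A2 A3 by apply: keep_tab3.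
  have H2 : has_input A2 by apply: input_keep K2 _ H'.
  split.
    apply: keep_trans K' (keep_trans (keep_sub _ K2) (keep_trans (keep_sub _ K3) _)).
    - by move=> j; rewrite !inE => ->.
    - by move=> j; rewrite !inE => ->.
    exact: keep_tab3.
  move=> a q1 q2; rewrite rd3_tab // (@tv_rd3 _ _ _ _ _ _ _ a q1 q2) // rd3_tab // tv_conj.
  rewrite [LHS]/= andbT [Bs _ _ _]/= inE; congr [&& _, _ & _].
  - by rewrite (@tv_rd3 _ _ _ _ _ _ _ a q1 q2) // (@rd3_keep _ 1 _ _ _ _ _ K2) // E'.
  - exact: tv_loopE.
  exact: tv_loopE.
set A2 := sem par env (SFor 0 0 body) A1 in K2 E2 *.
have H2 : has_input A2 by apply: input_keep K2 _ H.
have [K3 C3] := closure_ok 0 env H2 E2; split=> [|q1 q2 x y].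
  by apply: keep_trans K2 (keep_sub _ K3) => j; rewrite !inE => ->.
by rewrite C3 /max_loop card_ord.
Qed.

Lemma reach_step_ok env A (f : pred (Q * Q)) : has_input A ->
  (forall q1 q2 x y, rd4 A 3 q1 q2 x y = connect (edge tr (max_loop tr (q1, q2))) x y) ->
  (forall x y, rd2 A 5 x y = f (x, y)) ->
  keep [:: 0; 3] A (sem par env reach_step_prog A) /\
  forall x y, rd2 (sem par env reach_step_prog A) 5 x y = saturate (stepb tr) f (x, y).
Proof.
move=> H C F; rewrite /reach_step_prog !sem_seq.
set A1 := sem par env (tab2 2 6 _) A; set A2 := sem par env (tab2 2 4 _) A1.
have K1 : keep [:: 0; 3; 5] A A1 by apply: keep_tab2.
have K2 : keep [:: 0; 3] A1 A2 by apply: keep_tab2.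
have sub035 : {subset [:: 0; 3] <= [:: 0; 3; 5]} by move=> j; rewrite !inE => /orP[]->; rewrite ?orbT.
have H1 : has_input A1 by apply: input_keep K1 _ H.
have C1 q1 q2 x y : rd4 A1 3 q1 q2 x y = connect (edge tr (max_loop tr (q1, q2))) x y.
  by rewrite (@rd4_keep _ 3 _ _ _ _ _ _ K1).
have F1 x y : rd2 A1 5 x y = f (x, y) by rewrite (@rd2_keep _ 5 _ _ _ _ K1).
have D1 q1 q2 : rd2 A1 6 q1 q2 = [exists x, exists y, [&& f (x, y),
    connect (edge tr (max_loop tr (q1, q2))) x q1
    & connect (edge tr (max_loop tr (q1, q2))) y q2]].
  rewrite rd2_tab // tv_sum; apply: eq_existsb => x; rewrite tv_sum; apply: eq_existsb => y.
  rewrite tv_conj; cbn [all]; rewrite andbT -F -!C.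
  by congr [&& _, _ & _]; [apply: tv_rd2 | apply: tv_rd4 | apply: tv_rd4].
split; first by apply: keep_trans (keep_sub sub035 K1) (keep_trans K2 _); apply: keep_tab2.
move=> x y; rewrite rd2_tab // (@tv_rd2 _ _ _ _ _ _ x y) // rd2_tab // !tv_or.
rewrite (@tv_rd2 _ _ _ _ _ _ x y) // F1 /saturate; congr (_ || _).
have -> : tv A1 (upd (upd env 2 x) 3 y) (ESum 4 3 (ESum 5 3 (ESum 6 0 (conjE
      [:: EArr 5 (idx2 7 (EVar 4) (EVar 5)); union_transE 7 (EVar 4) (EVar 6) (EVar 2);
          union_transE 7 (EVar 5) (EVar 6) (EVar 3)])))) =
    [exists x' : Q, exists y' : Q, exists a, [&& f (x', y'), tr x' a x & tr y' a y]].
  rewrite tv_sum; apply: eq_existsb => x'; rewrite tv_sum; apply: eq_existsb => y'.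
  rewrite tv_sum; apply: eq_existsb => a; rewrite tv_conj; cbn [all]; rewrite andbT -F1.
  by congr [&& _, _ & _]; [apply: tv_rd2 | apply: tv_trans | apply: tv_trans].
have -> : tv A1 (upd (upd env 2 x) 3 y) (ESum 4 3 (ESum 5 3 (conjE
      [:: EArr 6 (idx2 6 (EVar 4) (EVar 5));
          get4 3 6 (EVar 4) (EVar 5) (EVar 4) (EVar 2);
          get4 3 6 (EVar 4) (EVar 5) (EVar 5) (EVar 3)]))) =
    [exists q1, exists q2, [&& rd2 A1 6 q1 q2,
      connect (edge tr (max_loop tr (q1, q2))) q1 x
      & connect (edge tr (max_loop tr (q1, q2))) q2 y]].
  rewrite tv_sum; apply: eq_existsb => q1; rewrite tv_sum; apply: eq_existsb => q2.
  rewrite tv_conj; cbn [all]; rewrite andbT -!C1.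
  by congr [&& _, _ & _]; [apply: tv_rd2 | apply: tv_rd4 | apply: tv_rd4].
(* The two sums are the two kinds of step; expanding array 6 by [D1] turns the second one into a
   jump from a reached pair. *)
apply/orP/existsP => [[/existsP[x' /existsP[y' /existsP[a /and3P[fz t1 t2]]]]|]|].
- by exists (x', y'); rewrite fz; apply/orP; left; apply/existsP; exists a; rewrite /= t1.
- case/existsP=> q1 /existsP[q2]; rewrite D1 => /and3P[/existsP[x' /existsP[y' /and3P[fz c1 c2]]] d1 d2].
  exists (x', y'); rewrite fz; apply/orP; right; apply/existsP; exists (q1, q2).
  by apply/and4P.
case=> [[x' y'] /andP[fz /orP[/existsP[a /= /andP[t1 t2]]|/existsP[[q1 q2] /and4P[/= c1 c2 d1 d2]]]]].
  by left; apply/existsP; exists x'; apply/existsP; exists y'; apply/existsP; exists a; rewrite fz t1.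
right; apply/existsP; exists q1; apply/existsP; exists q2; rewrite D1 d1 d2 !andbT.
by apply/existsP; exists x'; apply/existsP; exists y'; rewrite fz c1.
Qed.

Lemma decision_ok :
  tv (sem par (fun=> 0) decision_prog A0) (fun=> 0) decision_output <->
  PT_separable (nfa_lang M1) (nfa_lang M2).
Proof.
rewrite (separable_iff_saturated M1 M2) /decision_output tv_not.
rewrite /decision_prog !sem_seq; have [//|K1 C1] := @loops_ok (fun=> 0) A0.
set A1 := sem par _ loops_prog A0 in K1 C1 *.
set A2 := sem par _ (tab2 0 5 _) A1.
have K2 : keep [:: 0; 3] A1 A2 by apply: keep_tab2.
have H1 : has_input A1 by apply: input_keep K1 _ _.
pose f : pred (Q * Q) := fun p => on_left (nfa_init M1) p.1 && on_right (nfa_init M2) p.2.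
pose Inv i A' := keep [:: 0; 3] A1 A' /\
  forall x y, rd2 A' 5 x y = iter i (saturate (stepb tr)) f (x, y).
have [K3 F3] : Inv (par 3 * par 3) (sem par (fun=> 0) (SFor 0 3 (SFor 1 3 reach_step_prog)) A2).
  (* The outer loop counts blocks of n1+n2 rounds; inside a block the round number is i (n1+n2) +
     j. *)
  apply: (@sem_for_inv par (fun i => Inv (i * par 3))) => [|i A' _ I'].
    by split=> // x y; rewrite rd2_tab //; apply: tv_init.
  have := @sem_for_inv par (fun j => Inv (i * par 3 + j)) (upd (fun=> 0) 0 i) 1 3 reach_step_prog A'.
  rewrite addn0 addnC -mulSn; apply=> // j A3 _ [K3 F3]; rewrite addnS.
  have H3 : has_input A3 by apply: input_keep K3 _ H1.
  have C3 q1 q2 x y : rd4 A3 3 q1 q2 x y = connect (edge tr (max_loop tr (q1, q2))) x y.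
    by rewrite (@rd4_keep _ 3 _ _ _ _ _ _ K3).
  have [K4 F4] := @reach_step_ok (upd (upd (fun=> 0) 0 i) 1 j) A3 _ H3 C3 F3.
  by split; first exact: keep_trans K3 K4.
set A3 := sem par _ (SFor 0 3 _) A2 in K3 F3 *.
have H3 : has_input A3 by apply: input_keep K3 _ H1.
suff -> : tv A3 (fun=> 0) (ESum 0 3 (ESum 1 3 (conjE
      [:: EArr 5 (idx2 2 (EVar 0) (EVar 1)); on_final 2 (EVar 0) (EVar 1)]))) =
    [exists r : Q * Q, [&& iter #|{: Q * Q}| (saturate (stepb tr)) f r,
      on_left (nfa_final M1) r.1 & on_right (nfa_final M2) r.2]] by [].
have -> : #|{: Q * Q}| = par 3 * par 3 by rewrite card_prod card_ord.
transitivity [exists x, exists y, rd2 A3 5 x y &&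
    (on_left (nfa_final M1) x && on_right (nfa_final M2) y)].
  rewrite tv_sum; apply: eq_existsb => x; rewrite tv_sum; apply: eq_existsb => y.
  rewrite tv_conj; cbn [all]; rewrite andbT.
  by congr (_ && _); [apply: tv_rd2 | apply: tv_final].
apply/existsP/existsP => [[x /existsP[y]]|[[x y]]]; first by rewrite F3; exists (x, y).
by rewrite -F3; exists x; apply/existsP; exists y.
Qed.

End Correctness.

Theorem theorem1 :
  exists (P : seq instr) (c d : nat),
    forall (k n1 n2 : nat) (M1 : nfa k n1) (M2 : nfa k n2),
      let t := c * (n1 + n2 + k + 1) ^ d in
      halts_within P t (enc_input M1 M2) /\
      (output P t (enc_input M1 M2) = 1 <->
         PT_separable (nfa_lang M1) (nfa_lang M2)).
Proof.
have /and3P[ws wo to] := decision_wf.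
have [P [c [d H]]] := ram_realizes ws wo to; exists P, c, d => k n1 n2 M1 M2 t.
have sz := size_inp M1 M2.
have n2E : nth 0 (enc_input M1 M2) (n1 + n1 + n1 * (k * n1) + 2) = n2.
  rewrite /enc_input addn2; cbn [nth]; rewrite nth_cat size_enc_nfa addn1 ltnn subnn.
  by [].
have [||||| A [AE Ph Po]] := H (enc_input M1 M2) k n1 n2 => //.
- rewrite sz; apply/andP; split; first lia.
  (* The input has 3 + 2(n1+n2) + k(n1^2+n2^2) entries, well below the cubic bound; the power is
     unfolded for [nia]. *)
  have -> : 9 * (n1 + n2 + k + 1) ^ 3 =
    9 * ((n1 + n2 + k + 1) * ((n1 + n2 + k + 1) * (n1 + n2 + k + 1))) by rewrite !expnS expn0 muln1.
  nia.
- by rewrite sz; lia.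
split=> //; rewrite Po -(decision_ok AE) /tv /decision_output /notE; cbn [eval].
(* The outermost [notE] only takes the values 0 and 1, so being true means being equal to 1. *)
split=> [->//|]; lia.
Qed.
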